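(* Let $T>0$, $p<l<1$ and $u_0(x)\equiv 0$. Suppose that there is a constant $c_1>0$ such that $c(x,t)\ge c_1$ for $(x,t)\in\overline{Q_T}$. Then the solution $u\equiv 0$ of the problem $$u_t=\Delta u-c(x,t)u^p\ \ (x\in\Omega,\ t>0),\qquad \frac{\partial u(x,t)}{\partial\nu}=\int_{\Omega}k(x,y,t)u^l(y,t)\,dy\ \ (x\in\partial\Omega,\ t\ge0),\qquad u(x,0)=u_0(x)\ \ (x\in\Omega)$$ is unique in $Q_T$.
   Context: Standing assumptions: $n\ge 1$, $\Omega\subset\mathbb{R}^n$ is a bounded domain with smooth boundary $\partial\Omega$, $\nu$ is the unit outward normal on $\partial\Omega$; $p>0$, $l>0$; $c\in C^{\alpha}_{loc}(\overline\Omega\times[0,+\infty))$ with $0<\alpha<1$ (locally Hölder continuous) and $c(x,t)\ge 0$; $k\in C(\partial\Omega\times\overline\Omega\times[0,+\infty))$, $k(x,y,t)\ge 0$. Notation: for $T>0$, $Q_T=\Omega\times(0,T)$, $S_T=\partial\Omega\times(0,T)$, $\Gamma_T=S_T\cup(\overline\Omega\times\{0\})$. Definition: a nonnegative function $u\in C^{2,1}(Q_T)\cap C^{1,0}(Q_T\cup\Gamma_T)$ is a solution of the problem in $Q_T$ if $u_t=\Delta u-c(x,t)u^p$ for $(x,t)\in Q_T$, $\frac{\partial u(x,t)}{\partial\nu}=\int_\Omega k(x,y,t)u^l(y,t)\,dy$ for $x\in\partial\Omega$, $0\le t<T$, and $u(x,0)=u_0(x)$ for $x\in\Omega$. *)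

(* Defs.v *)
From HB Require Import structures.
From mathcomp Require Import all_boot all_order all_algebra.
From mathcomp Require Import all_classical all_reals all_analysis.

Set Implicit Arguments.
Unset Strict Implicit.
Unset Printing Implicit Defensive.

Import Order.TTheory GRing.Theory Num.Theory.
Import numFieldNormedType.Exports.

Local Open Scope classical_set_scope.
Local Open Scope ring_scope.

(* Lebesgue measure on R^n, as the n-fold product of the one-dimensional one:
   [lebesgue_tuple n.+1] is the image of [lebesgue_measure \x lebesgue_tuple n]
   under the identification of R * R^n with R^(n+1). *)
Section lebesgue_measure_tuple.
Context {R : realType}.
Let mR := measurableTypeR R.

Definition cons_pair n (p : mR * n.-tuple mR) : n.+1.-tuple mR :=
  [tuple of p.1 :: p.2].

Let uncons_pair n (t : n.+1.-tuple mR) : mR * n.-tuple mR :=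
  (thead t, [tuple of behead t]).

Let cons_pairK n : cancel (@cons_pair n) (@uncons_pair n).
Proof. by case=> x t; congr pair; exact/val_inj. Qed.

Lemma measurable_cons_pair n : measurable_fun setT (@cons_pair n).
Proof. exact: measurable_cons. Qed.

Let measurable_uncons_pair n : measurable_fun setT (@uncons_pair n).
Proof.
apply: measurable_fun_pair; last exact: measurable_behead.
exact: measurable_tnth.
Qed.

Section step.
Variables (n : nat) (mu : {sigma_finite_measure set (n.-tuple mR) -> \bar R}).

Definition lebesgue_cons : set (n.+1.-tuple mR) -> \bar R :=
  pushforward (lebesgue_measure \x mu)%E (@cons_pair n).

Let lebesgue_cons0 : lebesgue_cons set0 = 0%E.
Proof. by rewrite /lebesgue_cons /pushforward preimage_set0 measure0. Qed.

Let lebesgue_cons_ge0 A : (0 <= lebesgue_cons A)%E.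
Proof. by apply: integral_ge0 => x _; exact: measure_ge0. Qed.

Let lebesgue_cons_sigma_additive : semi_sigma_additive lebesgue_cons.
Proof.
have mc := @measurable_cons_pair n.
exact: (@measure_semi_sigma_additive _ _ _
  (pushforward (lebesgue_measure \x mu)%E (@cons_pair n))).
Qed.

HB.instance Definition _ := isMeasure.Build _ _ _ lebesgue_cons
  lebesgue_cons0 lebesgue_cons_ge0 lebesgue_cons_sigma_additive.

Let lebesgue_cons_sigma_finite : sigma_finite setT lebesgue_cons.
Proof.
have /sigma_finiteP[F [TF ndF Foo]] := sigma_finiteT (@lebesgue_measure R).
have /sigma_finiteP[G [TG ndG Goo]] := sigma_finiteT mu.
exists (fun k => @uncons_pair n @^-1` (F k `*` G k)).
  apply/esym; rewrite -subTset => t _.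
  have [i _ Fi] : (\bigcup_i F i) (thead t) by rewrite -TF.
  have [j _ Gj] : (\bigcup_j G j) [tuple of behead t] by rewrite -TG.
  exists (maxn i j) => //; split => /=.
  - by move: Fi; exact/subsetPset/ndF/leq_maxl.
  - by move: Gj; exact/subsetPset/ndG/leq_maxr.
move=> k; have [mF Fk] := Foo k; have [mG Gk] := Goo k; split.
  rewrite -[X in measurable X]setTI; apply: measurable_uncons_pair => //.
  exact: measurableX.
rewrite /lebesgue_cons /pushforward -comp_preimage.
rewrite (_ : _ \o _ = id); last by apply/funext => p /=; rewrite cons_pairK.
by rewrite preimage_id product_measure1E// lte_mul_pinfty// ge0_fin_numE.
Qed.

HB.instance Definition _ := Measure_isSigmaFinite.Build _ _ _ lebesgue_cons
  lebesgue_cons_sigma_finite.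

End step.

Fixpoint lebesgue_tuple n : {sigma_finite_measure set (n.-tuple mR) -> \bar R} :=
  if n is m.+1 then lebesgue_cons (lebesgue_tuple m) else \d_[tuple].

End lebesgue_measure_tuple.

Section euclidean.
Context {R : realType} {n : nat}.
Implicit Types (A D U : set 'rV[R]_n) (f rho : 'rV[R]_n -> R).

Definition row_of_tuple (t : n.-tuple (measurableTypeR R)) : 'rV[R]_n :=
  \row_i tnth t i.

(* Tuples carry the measurable structure, row vectors the topology. *)
Definition integral_rV D (F : 'rV[R]_n -> \bar R) : \bar R :=
  (\int[lebesgue_tuple n]_(t in row_of_tuple @^-1` D) F (row_of_tuple t))%E.

Definition dot (v w : 'rV[R]_n) : R := \sum_i v 0 i * w 0 i.

(* The library norm on row vectors is the sup norm. *)
Definition euclidean_norm (v : 'rV[R]_n) : R := Num.sqrt (dot v v).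

Definition basis_vec (i : 'I_n) : 'rV[R]_n := delta_mx 0 i.

Definition partial (i : 'I_n) f (x : 'rV[R]_n) : R := 'D_(basis_vec i) f x.

Definition gradient f (x : 'rV[R]_n) : 'rV[R]_n := \row_i partial i f x.

Definition laplacian f (x : 'rV[R]_n) : R :=
  \sum_(i < n) partial i (partial i f) x.

(* Only meaningful for open [U]. *)
Fixpoint Ck_on (k : nat) U f : Prop :=
  (forall x, U x -> {for x, continuous f}) /\
  if k is k'.+1 then
    forall i, (forall x, U x -> derivable f x (basis_vec i)) /\
              Ck_on k' U (partial i f)
  else True.

Definition smooth_on U f : Prop := forall k, Ck_on k U f.

Definition boundary A : set 'rV[R]_n := closure A `\` A°.

(* Inside [U] the set [A] is the sublevel set {rho < 0} and its boundary is the
   regular level set {rho = 0}; hence [gradient rho] points outward along the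
   boundary. *)
Definition defining_function A U rho : Prop :=
  [/\ open U,
      smooth_on U rho,
      forall x, U x -> gradient rho x != 0,
      forall x, U x -> (A x <-> rho x < 0) &
      forall x, U x -> (boundary A x <-> rho x = 0)].

Definition smooth_boundary A : Prop :=
  forall x, boundary A x -> exists U rho, U x /\ defining_function A U rho.

Definition smooth_bounded_domain A : Prop :=
  [/\ A !=set0, open A, connected A, bounded_set A & smooth_boundary A].

Definition outward_unit_normal A (x v : 'rV[R]_n) : Prop :=
  exists U rho, [/\ U x, defining_function A U rho &
    v = (euclidean_norm (gradient rho x))^-1 *: gradient rho x].

(* For closed [A], as below, this is the same as asking for a neighbourhood of
   each point of [A] on which [f] is Hoelder continuous. *)
Definition locally_hoelder (alpha : R) (A : set ('rV[R]_n * R))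
    (f : 'rV[R]_n * R -> R) : Prop :=
  forall K, compact K -> K `<=` A -> exists C : R,
    forall z z', K z -> K z' -> `|f z - f z'| <= C * `|z - z'| `^ alpha.

End euclidean.

Section problem.
Context {R : realType} {n : nat}.
Variables (Omega : set 'rV[R]_n) (T : R).

Definition parabolic_Q : set ('rV[R]_n * R) := Omega `*` `]0, T[%classic.

Definition parabolic_S : set ('rV[R]_n * R) :=
  boundary Omega `*` `]0, T[%classic.

Definition parabolic_Gamma : set ('rV[R]_n * R) :=
  parabolic_S `|` (closure Omega `*` [set 0]).

Definition C21 (u : 'rV[R]_n -> R -> R) : Prop :=
  [/\ forall z, parabolic_Q z ->
        [/\ derivable (u z.1) z.2 1,
            forall i, derivable (u^~ z.2) z.1 (basis_vec i) &
            forall i j, derivable (partial i (u^~ z.2)) z.1 (basis_vec j)],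
      {within parabolic_Q, continuous (fun z => u z.1 z.2)},
      {within parabolic_Q, continuous (fun z => derive1 (u z.1) z.2)},
      forall i, {within parabolic_Q, continuous
        (fun z => partial i (u^~ z.2) z.1)} &
      forall i j, {within parabolic_Q, continuous
        (fun z => partial j (partial i (u^~ z.2)) z.1)}].

(* [u] is C^{1,0} on Q_T \cup Gamma_T and [g] is its spatial gradient there: at
   lateral boundary points the gradient is the continuous extension of the
   gradient at interior points. *)
Definition C10_gradient (u : 'rV[R]_n -> R -> R)
    (g : 'rV[R]_n -> R -> 'rV[R]_n) : Prop :=
  [/\ {within parabolic_Q `|` parabolic_Gamma,
        continuous (fun z => u z.1 z.2)},
      {within parabolic_Q `|` parabolic_Gamma,
        continuous (fun z => g z.1 z.2)} &
      forall x t, Omega x -> (parabolic_Q `|` parabolic_Gamma) (x, t) ->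
        (forall i, derivable (u^~ t) x (basis_vec i)) /\
        gradient (u^~ t) x = g x t].

Definition is_solution (nu : 'rV[R]_n -> 'rV[R]_n) (p l : R)
    (c : 'rV[R]_n -> R -> R) (k : 'rV[R]_n -> 'rV[R]_n -> R -> R)
    (u0 : 'rV[R]_n -> R) (u : 'rV[R]_n -> R -> R) : Prop :=
  [/\ forall x t, (parabolic_Q `|` parabolic_Gamma) (x, t) -> 0 <= u x t,
      C21 u,
      forall x t, parabolic_Q (x, t) ->
        derive1 (u x) t = laplacian (u^~ t) x - c x t * u x t `^ p,
      exists2 g, C10_gradient u g &
        forall x t, boundary Omega x -> 0 <= t < T ->
          (dot (g x t) (nu x))%:E =
          integral_rV Omega (fun y => (k x y t * u y t `^ l)%:E) &
      forall x, Omega x -> u x 0 = u0 x].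

End problem.

(* Main.v *)
Require Import Defs.
From mathcomp Require Import all_boot all_order all_algebra.
From mathcomp Require Import all_classical all_reals all_analysis.
From mathcomp Require Import measurable_realfun.
From mathcomp Require Import ring lra.

Import Order.TTheory GRing.Theory Num.Theory.
Import numFieldNormedType.Exports.

Local Open Scope classical_set_scope.
Local Open Scope ring_scope.

Set Implicit Arguments.
Unset Strict Implicit.

(** Why the theorem holds.  A solution that starts from zero can only be fed
    through the boundary, and the absorption [c u^p] is so strong at small
    heights that it destroys the mass faster than the flux [\int k u^l] supplies
    it.  The comparison is made at the first time [t0] when the maximum of [u]
    equals a small height [M] (lemma [first_time]).

    Put [q = c1 (M/2)^p / (2n)].  Where [u > M/2], the absorption exceeds
    [2 n q], the Laplacian of the paraboloid [q |x - y|^2], so such paraboloids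
    are barriers for [u] (lemma [comparison]).  The length [s] defined by
    [q s^2 = M/2] is the radius over which the paraboloid climbs from [M/2] to
    [M].  Two barriers are used.
    - A paraboloid with vertex at height [M/2] above an interior point shows that
      [u <= M/2] there, if [u <= M] on the ball of radius [s] around it.
      Repeating this with [M/2], [M/4], ... uses up lengths which decrease
      geometrically, as [s] is proportional to [M^((1-p)/2)] and [p < 1].  So
      [u] vanishes at every point whose depth in the domain exceeds a constant
      multiple of [s] (lemma [dead_core]).
    - A maximum point at time [t0] lies on the boundary.  A paraboloid equal to
      [M] on the sphere of radius [s] which touches the boundary there from
      inside shows that the normal derivative is at least [2 q s] (lemma
      [boundary_slope]).
    On the other hand, [u(., t0)] is at most [M] and lives in a boundary layer of
    thickness proportional to [s], whose measure is at most a constant times [s]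
    (lemma [boundary_layer_measure]).  So the flux is at most a constant times
    [M^l s], and [2 q s <= C M^l s], which is [M^p <= C' M^l]
    (lemma [max_flux_balance]).  As [p < l], this fails when [M] is small.

    Two facts on the domain enter: interior tangent balls of uniform radius and
    the linear bound on the measure of the layer.  Both are proved near one
    boundary point, with a defining function whose derivatives up to order two
    are controlled, and made uniform by compactness of the boundary. *)

(** * Derivatives along lines and in coordinates *)

Lemma continuous_pairr {X Y : topologicalType} (y : Y) :
  continuous (fun x : X => (x, y)).
Proof. by move=> x; apply: cvg_pair; [exact: cvg_id|exact: cvg_cst]. Qed.

Section within.
Context {X Y Z : topologicalType}.

Lemma within_continuous_precomp (A : set Y) (B : set X) (f : Y -> Z) (h : X -> Y) :
  continuous h -> (forall b, B b -> A (h b)) ->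
  {within A, continuous f} -> {within B, continuous (f \o h)}.
Proof.
move=> ch hBA /subspace_continuousP cf; apply/subspace_continuousP => b Bb.
move=> W /(cf _ (hBA _ Bb)); move=> /ch H.
by apply: (@filterS _ (nbhs b) _ _ _ _ H) => x {}H Bx; apply: H; exact: hBA.
Qed.

End within.

Lemma within_continuous_eps {R : realType} {V : normedModType R} (A : set V)
    (f : V -> R) x : {within A, continuous f} -> A x ->
  forall e, 0 < e -> exists2 d, 0 < d &
    forall z, A z -> `|z - x| < d -> `|f z - f x| < e.
Proof.
move=> /subspace_continuousP cf Ax e e0.
have /cvgrPdist_lt/(_ _ e0) := cf x Ax.
rewrite /within /= => /nbhs_ballP[d /= d0 H]; exists d => // z Az zx.
rewrite distrC; apply: H => //.
by rewrite -ball_normE /= distrC.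
Qed.

Section calculus.
Context {R : realType}.

Section lines.
Context {V : normedModType R}.
Implicit Types (f : V -> R) (x v : V).

Lemma is_derive_line f x v (h : R) : derivable f (h *: v + x) v ->
  is_derive h 1 (fun h => f (h *: v + x)) ('D_v f (h *: v + x)).
Proof.
move=> fv; have E : (fun k : R => k^-1 *: (((fun h => f (h *: v + x)) \o shift h) (k *: 1)
     - f (h *: v + x)))
   = (fun k : R => k^-1 *: ((f \o shift (h *: v + x)) (k *: v) - f (h *: v + x))).
  apply/funext => k /=.
  by rewrite [k *: 1]mulr1 scalerDl -addrA.
apply: DeriveDef; first by rewrite /derivable E.
by rewrite /derive E.
Qed.

Lemma mvt_line f x v (a : R) :
  (forall h, 0 <= h <= 1 -> derivable f ((h * a) *: v + x) v) ->
  exists2 h, 0 <= h <= 1 &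
    f (a *: v + x) - f x = a * 'D_v f ((h * a) *: v + x).
Proof.
move=> fd; pose g h := f (h *: v + x).
have -> : f x = g 0 by rewrite /g scale0r add0r.
rewrite -/(g a).
have [->|a0] := eqVneq a 0.
  by exists 0; rewrite ?lexx ?ler01// subrr mul0r.
have gd b : 0 <= b / a <= 1 -> is_derive b 1 g ('D_v f (b *: v + x)).
  by move=> ba; apply: is_derive_line; have := fd _ ba; rewrite divfK.
have [agt|ale] := ltP 0 a.
  have gd' b : b \in `[0, a]%R -> 0 <= b / a <= 1.
    by rewrite in_itv/= ler_pdivrMr// mul1r ler_pdivlMr// mul0r.
  have D b : b \in `]0, a[%R -> is_derive b 1 g ('D_v f (b *: v + x)).
    by move=> bI; apply: gd; apply: gd'; apply: subset_itvW bI.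
  have C : {within `[0, a], continuous g}.
    by apply: derivable_within_continuous => b bI; case: (gd b (gd' b bI)).
  have [b bI] := MVT_segment (ltW agt) D C.
  rewrite subr0 mulrC => ->; exists (b / a); first exact: gd'.
  by rewrite divfK.
have alt : a < 0 by rewrite lt_neqAle a0.
have gd' b : b \in `[a, 0]%R -> 0 <= b / a <= 1.
  by rewrite in_itv/= ler_ndivrMr// mul1r ler_ndivlMr// mul0r andbC.
have D b : b \in `]a, 0[%R -> is_derive b 1 g ('D_v f (b *: v + x)).
  by move=> bI; apply: gd; apply: gd'; apply: subset_itvW bI.
have C : {within `[a, 0], continuous g}.
  by apply: derivable_within_continuous => b bI; case: (gd b (gd' b bI)).
have [b bI E] := MVT_segment (ltW alt) D C.
exists (b / a); first exact: gd'.
by rewrite divfK// -opprB E sub0r mulrN opprK mulrC.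
Qed.

End lines.

Lemma derive_eps {V : normedModType R} (f : V -> R) x v : derivable f x v ->
  forall e, 0 < e -> exists2 d, 0 < d & forall h, h != 0 -> `|h| < d ->
    `|h^-1 * (f (h *: v + x) - f x) - 'D_v f x| < e.
Proof.
move=> fd e e0; have /cvgrPdist_lt/(_ _ e0) := fd.
rewrite near_withinE => /nbhs_ballP[d /= d0 H]; exists d => // h h0 hd.
have := H h; rewrite /ball/= sub0r normrN => /(_ hd h0).
by rewrite distrC.
Qed.

Lemma is_derive_eps {V : normedModType R} (f : V -> R) x v (L : R) :
  (forall e, 0 < e -> exists2 d, 0 < d & forall h, h != 0 -> `|h| < d ->
    `|h^-1 * (f (h *: v + x) - f x) - L| < e) -> is_derive x v f L.
Proof.
move=> H; have fL : (fun h => h^-1 *: ((f \o shift x) (h *: v) - f x)) @ 0^' --> L.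
  apply/cvgrPdist_lt => e e0; have [d d0 Hd] := H _ e0.
  rewrite near_withinE; apply/nbhs_ballP; exists d => //= h.
  by rewrite /ball/= sub0r normrN => hd h0; rewrite distrC; exact: Hd.
apply: DeriveDef; first by apply/cvg_ex; exists L.
exact: cvg_lim fL.
Qed.

(** If the second derivative were positive, the first one would be positive just
    to the right of the critical point, and the mean value theorem would give a
    larger value there. *)
Lemma derive2_at_max (f f1 : R -> R) (f2 d : R) : 0 < d ->
  (forall t : R, `|t| < d -> is_derive t 1 f (f1 t)) ->
  is_derive (0 : R) 1 f1 f2 ->
  (forall t, `|t| < d -> f t <= f 0) -> f2 <= 0.
Proof.
move=> d0 fd f2d fmax.
have f10 : f1 0 = 0.
  have fd0 : is_derive (0 : R) 1 f (f1 0) by apply: fd; rewrite normr0.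
  rewrite -[LHS](@derive_val _ _ _ _ _ _ _ fd0).
  apply: derive_val.
  apply: (@derive1_at_max _ f (- d) d 0) => //.
  - lra.
  - by move=> t; rewrite in_itv/= -ltr_norml => /fd[].
  - by rewrite in_itv/= d0 oppr_lt0 d0.
  - by move=> t; rewrite in_itv/= -ltr_norml; exact: fmax.
rewrite leNgt; apply/negP => f20.
have f1d : derivable f1 0 1 by case: f2d.
have [r r0 H] := derive_eps f1d f20.
pose a := Num.min d r / 2.
have m0 : 0 < Num.min d r by rewrite lt_min d0.
have a0 : 0 < a by rewrite divr_gt0.
have /andP[ad ar] : (a < d) && (a < r).
  by rewrite -lt_min /a ltr_pdivrMr// ltr_pMr// ltr1n.
have fd' (h : R) : 0 <= h <= a -> is_derive h 1 f (f1 h).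
  by move=> /andP[h0 ha]; apply: fd; rewrite ger0_norm// (le_lt_trans ha).
have D (b : R) : b \in `]0, a[%R -> is_derive b 1 f (f1 b).
  by rewrite in_itv/= => /andP[b0 ba]; apply: fd'; rewrite !ltW.
have C : {within `[0, a], continuous f}.
  apply: derivable_within_continuous => y.
  by rewrite in_itv/= => /fd'[].
have [c cI E] := MVT a0 D C.
move: cI; rewrite in_itv/= => /andP[c0 ca].
have := H c; rewrite gt_eqF// gtr0_norm// (lt_trans ca ar) => /(_ isT isT).
rewrite (@derive_val _ _ _ _ _ _ _ f2d).
rewrite f10 subr0 addr0 [_ *: 1]mulr1 ltr_norml => /andP[+ _] => fc.
have {fc} : 0 < c^-1 * f1 c by lra.
rewrite pmulr_rgt0 ?invr_gt0// => fc0.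
have := fmax a; rewrite gtr0_norm// => /(_ ad).
by rewrite -subr_le0 E subr0 leNgt mulr_gt0.
Qed.

(** Only the past of [t] is used: a touching point is a maximum over earlier
    times, and nothing is known after it. *)
Lemma derive_ge0_left_max (f : R -> R) (t d : R) : 0 < d -> derivable f t 1 ->
  (forall s, t - d < s -> s <= t -> f s <= f t) -> 0 <= 'D_1 f t.
Proof.
move=> d0 fd fmax; rewrite leNgt; apply/negP => D0.
have D0' : 0 < - 'D_1 f t by rewrite oppr_gt0.
have [r r0 H] := derive_eps fd D0'.
pose a := Num.min d r / 2.
have m0 : 0 < Num.min d r by rewrite lt_min d0.
have a0 : 0 < a by rewrite divr_gt0.
have /andP[ad ar] : (a < d) && (a < r).
  by rewrite -lt_min /a ltr_pdivrMr// ltr_pMr// ltr1n.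
have := H (- a); rewrite oppr_eq0 gt_eqF// normrN gtr0_norm// => /(_ isT ar).
rewrite [_ *: 1]mulr1 ltr_norml => /andP[_] => fa0.
suff : 0 <= (- a)^-1 * (f (- a + t) - f t) by lra.
move=> {fa0}.
have := fmax (- a + t); rewrite ltrBlDr => fa.
rewrite invrN mulNr oppr_ge0 pmulr_rle0 ?invr_gt0// subr_le0; apply: fa; lra.
Qed.

Lemma le_rV_norm n (w : 'rV[R]_n) (r : R) : 0 <= r ->
  (forall i, `|w 0 i| <= r) -> `|w| <= r.
Proof.
move=> r0 H; rewrite [leLHS]/Num.norm /= mx_normrE; apply/bigmax_leP.
split=> // -[i j] _ /=.
by rewrite (ord1 i).
Qed.

Lemma lt_rV_norm n (w : 'rV[R]_n) (r : R) : 0 < r ->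
  (forall i, `|w 0 i| < r) -> `|w| < r.
Proof.
move=> r0 H; rewrite [ltLHS]/Num.norm /= mx_normrE; apply/bigmax_ltP.
split=> // -[i j] _ /=.
by rewrite (ord1 i).
Qed.

Lemma rV_norm_coord n (w : 'rV[R]_n) i : `|w 0 i| <= `|w|.
Proof.
by rewrite [leRHS]/Num.norm /= mx_normrE; apply/bigmax_geP; right => /=; exists (0, i).
Qed.

Section partials.
Context {n : nat}.
Implicit Types (f : 'rV[R]_n -> R) (x w : 'rV[R]_n).

(** The increment is telescoped along the edges of the box spanned by [x] and
    [w + x], one coordinate at a time, with the mean value theorem on each edge.
    Closeness is measured in the sup norm, so a ball contains all these edges. *)
Lemma partial_increment f x w :
  (forall z, `|z - x| <= `|w| -> forall i, derivable f z (basis_vec i)) ->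
  exists2 z : 'I_n -> 'rV[R]_n, forall i, `|z i - x| <= `|w| &
    f (w + x) - f x = \sum_i w 0 i * partial i f (z i).
Proof.
move=> fd; pose W k : 'rV[R]_n := \row_j (if (j < k)%N then w 0 j else 0).
have WS (i : 'I_n) : W i.+1 = w 0 i *: basis_vec i + W i.
  apply/rowP => j; rewrite !mxE eqxx /= ltnS leq_eqVlt -val_eqE /= eq_sym.
  case: (ltngtP i j) => [ij|ij|ij]; rewrite /= ?mulr0 ?mulr1 ?add0r ?addr0//.
  by rewrite (val_inj ij).
have step (i : 'I_n) : exists2 z, `|z - x| <= `|w| &
    f (W i.+1 + x) - f (W i + x) = w 0 i * partial i f z.
  have near h : 0 <= h <= 1 -> `|(h * w 0 i) *: basis_vec i + (W i + x) - x| <= `|w|.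
    move=> /andP[h0 h1]; rewrite addrA addrK; apply: le_rV_norm => // j.
    rewrite !mxE eqxx /=; have [->|ji] := eqVneq j i.
      rewrite ltnn /= mulr1 addr0 normrM ger0_norm//.
      apply: le_trans (rV_norm_coord w i).
      by rewrite ler_piMl.
    rewrite mulr0 add0r; case: ifP => _; first exact: rV_norm_coord.
    by rewrite normr0.
  have [h hI E] := mvt_line (fun h hI => fd _ (near h hI) i).
  exists ((h * w 0 i) *: basis_vec i + (W i + x)); first exact: near.
  by rewrite WS -addrA E.
have /choice[z zP] (i : 'I_n) : exists z, `|z - x| <= `|w| /\
    f (W i.+1 + x) - f (W i + x) = w 0 i * partial i f z.
  by have [z] := step i; exists z.
exists z => [i|]; first by case: (zP i).
have zE i := (zP i).2.
rewrite (eq_bigr (fun i : 'I_n => f (W i.+1 + x) - f (W i + x))); last first.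
  by move=> i _; rewrite zE.
rewrite -(big_mkord xpredT (fun i => f (W i.+1 + x) - f (W i + x))).
rewrite telescope_sumr//; congr (f (_ + _) - f _).
  by apply/rowP => j; rewrite mxE ltn_ord.
rewrite -[LHS]add0r; congr (_ + _); by apply/rowP => j; rewrite !mxE.
Qed.

(** Continuous partial derivatives give all directional derivatives: the
    intermediate points of [partial_increment] tend to [x]. *)
Lemma C1_is_derive f x (d : R) : 0 < d ->
  (forall z, `|z - x| < d -> forall i, derivable f z (basis_vec i)) ->
  (forall i, {for x, continuous (partial i f)}) ->
  forall v, is_derive x v f (dot (gradient f x) v).
Proof.
move=> d0 fd fc v; apply: is_derive_eps => e e0.
have v0 : 0 < `|v| + 1 by rewrite ltr_wpDl.
have B0 : 0 < n%:R * (`|v| + 1) + 1 :> R.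
  by rewrite ltr_wpDl// mulr_ge0// ltW.
pose e' := e / (n%:R * (`|v| + 1) + 1).
have e'0 : 0 < e' by rewrite divr_gt0.
have [r r0 H] : exists2 r, 0 < r & forall z, `|z - x| < r -> forall i,
    `|partial i f z - partial i f x| < e'.
  have : \forall z \near x, forall i, `|partial i f z - partial i f x| < e'.
    apply: (@filter_forall _ _ (fun i z => `|partial i f z - partial i f x| < e')
      (nbhs x) (nbhs_filter x)) => i.
    have /cvgrPdist_lt/(_ _ e'0) := fc i.
    by apply: filterS => z; rewrite distrC.
  move=> /nbhs_ballP[r /= r0 H]; exists r => // z zr; apply: H.
  by rewrite -ball_normE /= distrC.
have m0 : 0 < Num.min d r by rewrite lt_min d0.
exists (Num.min d r / (`|v| + 1)); first by rewrite divr_gt0.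
move=> h h0; rewrite ltr_pdivlMr// => hd.
have hv : `|h *: v| < Num.min d r.
  by rewrite normrZ (le_lt_trans _ hd)// ler_wpM2l// lerDl.
have {}fd z : `|z - x| <= `|h *: v| -> forall i, derivable f z (basis_vec i).
  move=> zx; apply: fd; rewrite (le_lt_trans zx)// (lt_le_trans hv)//.
  by rewrite ge_min lexx.
have [z zx ->] := partial_increment fd.
have -> : h^-1 * (\sum_i (h *: v) 0 i * partial i f (z i)) - dot (gradient f x) v =
    \sum_i v 0 i * (partial i f (z i) - partial i f x).
  rewrite mulr_sumr /dot -sumrB; apply: eq_bigr => i _.
  by rewrite !mxE -mulrA mulKf// mulrBr [in X in _ - X]mulrC.
apply: (@le_lt_trans _ _ (\sum_(i < n) (`|v| + 1) * e')).
  apply: le_trans (ler_norm_sum _ _ _) _; apply: ler_sum => i _.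
  rewrite normrM ler_pM//.
    by rewrite (le_trans (rV_norm_coord v i))// lerDl.
  apply/ltW/H; rewrite (le_lt_trans (zx i))// (lt_le_trans hv)//.
  by rewrite ge_min lexx orbT.
rewrite sumr_const card_ord -mulr_natl mulrA /e' mulrCA gtr_pMr//.
by rewrite ltr_pdivrMr// mul1r ltrDl.
Qed.

Lemma dotC (v w : 'rV[R]_n) : dot v w = dot w v.
Proof. by apply: eq_bigr => i _; rewrite mulrC. Qed.

Lemma dotDr (v w1 w2 : 'rV[R]_n) : dot v (w1 + w2) = dot v w1 + dot v w2.
Proof. by rewrite /dot -big_split; apply: eq_bigr => i _; rewrite mxE mulrDr. Qed.

Lemma dotZr (v w : 'rV[R]_n) a : dot v (a *: w) = a * dot v w.
Proof. by rewrite /dot mulr_sumr; apply: eq_bigr => i _; rewrite mxE mulrCA. Qed.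

Lemma dotNr (v w : 'rV[R]_n) : dot v (- w) = - dot v w.
Proof. by rewrite -scaleN1r dotZr mulN1r. Qed.

Lemma dotBr (v w1 w2 : 'rV[R]_n) : dot v (w1 - w2) = dot v w1 - dot v w2.
Proof. by rewrite dotDr dotNr. Qed.

Lemma dotDl (v w1 w2 : 'rV[R]_n) : dot (w1 + w2) v = dot w1 v + dot w2 v.
Proof. by rewrite dotC dotDr !(dotC v). Qed.

Lemma dotZl (v w : 'rV[R]_n) a : dot (a *: v) w = a * dot v w.
Proof. by rewrite dotC dotZr dotC. Qed.

Lemma dot_line (v w : 'rV[R]_n) h :
  dot (h *: v + w) (h *: v + w) = dot w w + h * (2 * dot v w + h * dot v v).
Proof. by rewrite !dotDl !dotDr !dotZl !dotZr (dotC w v); ring. Qed.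

Lemma dot_basis (w : 'rV[R]_n) i : dot (basis_vec i) w = w 0 i.
Proof.
rewrite /dot (bigD1 i)//= big1 ?addr0; first by rewrite !mxE !eqxx mul1r.
by move=> j /negPf ji; rewrite !mxE eqxx ji mul0r.
Qed.

Lemma dot_ge0 (v : 'rV[R]_n) : 0 <= dot v v.
Proof. by apply: sumr_ge0 => i _; rewrite -expr2 sqr_ge0. Qed.

Lemma sqr_coord_le_dot (v : 'rV[R]_n) i : v 0 i ^+ 2 <= dot v v.
Proof.
rewrite /dot (bigD1 i)//= -expr2 lerDl; apply: sumr_ge0 => j _.
by rewrite -expr2 sqr_ge0.
Qed.

Lemma dot_eq0 (v : 'rV[R]_n) : dot v v = 0 -> v = 0.
Proof.
move=> v0; apply/rowP => i; rewrite mxE; apply/eqP.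
by rewrite -sqrf_eq0 eq_le sqr_ge0 -v0 sqr_coord_le_dot.
Qed.

Lemma sqr_norm_le_dot (v : 'rV[R]_n) : `|v| ^+ 2 <= dot v v.
Proof.
have : `|v| <= Num.sqrt (dot v v).
  apply: le_rV_norm => [|i]; first exact: sqrtr_ge0.
  by rewrite -sqrtr_sqr ler_wsqrtr// sqr_coord_le_dot.
by rewrite -ler_sqr ?nnegrE ?sqrtr_ge0// sqr_sqrtr// dot_ge0.
Qed.

Lemma dot_le (v w : 'rV[R]_n) : `|dot v w| <= n%:R * (`|v| * `|w|).
Proof.
apply: le_trans (ler_norm_sum _ _ _) _.
apply: (@le_trans _ _ (\sum_(i < n) `|v| * `|w|)).
  by apply: ler_sum => i _; rewrite normrM ler_pM// rV_norm_coord.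
by rewrite sumr_const card_ord mulr_natl.
Qed.

End partials.

End calculus.

(** * Comparison with paraboloids *)

Section comparison.
Context {R : realType} {n : nat}.
Implicit Types (x y z : 'rV[R]_n).

Lemma continuous_dot_sub y : continuous (fun z : 'rV[R]_n => dot (z - y) (z - y)).
Proof.
move=> z; rewrite /dot; apply: (cvg_big add_continuous (nbhs_filter z)) => i _.
have E : {for z, continuous (fun w : 'rV[R]_n => (w - y) 0 i)}.
  have -> : (fun w : 'rV[R]_n => (w - y) 0 i) = (fun w => w 0 i - y 0 i).
    by apply/funext => w; rewrite !mxE.
  apply: continuousB; last exact: cst_continuous.
  exact: coord_continuous.
exact: (continuousM E E).
Qed.

Lemma continuous_quadratic (q : R) y :
  continuous (fun z : 'rV[R]_n * R => q * dot (z.1 - y) (z.1 - y)).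
Proof.
move=> z; have Ez : {for z, continuous (fun z : 'rV[R]_n * R =>
    dot (z.1 - y) (z.1 - y))}.
  apply: (@continuous_comp _ _ _ (fst : 'rV[R]_n * R -> _)
    (fun w => dot (w - y) (w - y))); first exact: cvg_fst.
  exact: continuous_dot_sub.
exact: (continuousM (@cst_continuous _ _ q z) Ez).
Qed.

(** At a maximum of [f - q |. - y|^2] the second derivative test applies on the
    coordinate line through [x], where the paraboloid has second derivative
    [2 q]. *)
Lemma second_partial_le (f : 'rV[R]_n -> R) x y (q d : R) i : 0 < d ->
  (forall z, `|z - x| < d -> derivable f z (basis_vec i)) ->
  derivable (partial i f) x (basis_vec i) ->
  (forall z, `|z - x| < d ->
    f z - q * dot (z - y) (z - y) <= f x - q * dot (x - y) (x - y)) ->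
  partial i (partial i f) x <= 2 * q.
Proof.
move=> d0 fd f2 fmax.
pose L h := h *: basis_vec i + x : 'rV[R]_n.
have Ld h : `|h| < d -> `|L h - x| < d.
  move=> hd; apply: lt_rV_norm => // j; rewrite /L addrK !mxE eqxx /=.
  by case: (j == i); rewrite /= ?mulr1// mulr0 normr0.
pose b := (x - y) 0 i.
have dotL h : dot (L h - y) (L h - y) = dot (x - y) (x - y) + h * (2 * b + h).
  rewrite /L -addrA dot_line !dot_basis.
  by rewrite (_ : basis_vec i 0 i = 1) ?mulr1// !mxE !eqxx.
pose phi h := f (L h) - q * dot (L h - y) (L h - y).
pose phi1 h := partial i f (L h) - q * (2 * (b + h)).
have L0 : L 0 = x by rewrite /L scale0r add0r.
have phid (h : R) : `|h| < d -> is_derive h 1 phi (phi1 h).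
  move=> hd; apply: is_deriveB.
    by apply: is_derive_line; apply: fd; exact: Ld.
  have -> : (fun h => q * dot (L h - y) (L h - y)) =
      fun h => q * (dot (x - y) (x - y) + h * (2 * b + h)).
    by apply/funext => k; rewrite dotL.
  apply: is_derive_eq.
  rewrite /GRing.scale /=.
  by ring.
suff : partial i (partial i f) x - 2 * q <= 0 by rewrite subr_le0.
apply: (@derive2_at_max _ phi phi1 _ d d0 phid).
- apply: is_deriveB.
    have : derivable (partial i f) (0 *: basis_vec i + x) (basis_vec i).
      by rewrite scale0r add0r.
    by move=> /is_derive_line; rewrite scale0r add0r.
  apply: is_derive_eq; rewrite /GRing.scale /=.
  by rewrite add0r mulr1 mulrC.
- move=> t td; rewrite /phi L0; apply: fmax; exact: Ld.
Qed.

Lemma laplacian_le (f : 'rV[R]_n -> R) x y (q d : R) : 0 < d ->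
  (forall z i, `|z - x| < d -> derivable f z (basis_vec i)) ->
  (forall i, derivable (partial i f) x (basis_vec i)) ->
  (forall z, `|z - x| < d ->
    f z - q * dot (z - y) (z - y) <= f x - q * dot (x - y) (x - y)) ->
  laplacian f x <= 2 * n%:R * q.
Proof.
move=> d0 fd f2 fmax; apply: (@le_trans _ _ (\sum_(i < n) 2 * q)).
  by apply: ler_sum => i _; apply: (@second_partial_le f x y q d) => // z zx; exact: fd.
by rewrite sumr_const card_ord -[_ *+ n]mulr_natr mulrAC.
Qed.

End comparison.

(** What the barrier arguments use of a solution: an inequality with a constant
    absorption rate, inside the domain, and zero initial values up to the
    boundary.  The boundary condition enters only in the final balance. *)
Record absorption_subsolution {R : realType} {n : nat} (Omega : set 'rV[R]_n)
    (T p c1 : R) (u : 'rV[R]_n -> R -> R) : Prop := AbsorptionSubsolution {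
  sub_open : open Omega;
  sub_exponent : 0 < p < 1;
  sub_rate : 0 < c1;
  sub_cont : {within closure Omega `*` `[0, T[%classic,
    continuous (fun z : 'rV[R]_n * R => u z.1 z.2)};
  sub_init : forall x, closure Omega x -> u x 0 = 0;
  sub_dt : forall x t, Omega x -> 0 < t < T -> derivable (u x) t 1;
  sub_dx : forall x t i, Omega x -> 0 < t < T ->
    derivable (u^~ t) x (basis_vec i);
  sub_dxx : forall x t i, Omega x -> 0 < t < T ->
    derivable (partial i (u^~ t)) x (basis_vec i);
  sub_ineq : forall x t, Omega x -> 0 < t < T ->
    'D_1 (u x) t <= laplacian (u^~ t) x - c1 * u x t `^ p }.

Section reaction_diffusion.
Context {R : realType} {n : nat}.
Variables (Omega : set 'rV[R]_n) (T p c1 : R) (u : 'rV[R]_n -> R -> R).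
Hypothesis hu : absorption_subsolution Omega T p c1 u.

(** At a point where [u - q |. - y|^2] is maximal in space and [u] is maximal
    among earlier times, the time derivative is nonnegative and the Laplacian is
    at most that of the paraboloid, so the absorption is at most [2 n q]. *)
Lemma absorption_le_at_max x t y (q d : R) : Omega x -> 0 < t < T -> 0 < d ->
  (forall z, `|z - x| < d ->
    u z t - q * dot (z - y) (z - y) <= u x t - q * dot (x - y) (x - y)) ->
  (forall s, t - d < s -> s <= t -> u x s <= u x t) ->
  c1 * u x t `^ p <= 2 * n%:R * q.
Proof.
move=> Ox tT d0 zmax smax.
have ut := sub_dt hu Ox tT.
have := derive_ge0_left_max d0 ut smax.
move=> /le_trans/(_ (sub_ineq hu Ox tT)); rewrite subr_ge0.
move=> /le_trans; apply.
have [e /= e0 He] : exists2 e, 0 < e & forall z, `|z - x| < e -> Omega z.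
  have /nbhs_ballP[e /= e0 He] := open_nbhs_nbhs (conj (sub_open hu) Ox).
  by exists e => // z zx; apply: He; rewrite -ball_normE /= distrC.
apply: (@laplacian_le _ _ _ x y q (Num.min d e)).
- by rewrite lt_min d0.
- by move=> z i; rewrite lt_min => /andP[_ /He Oz]; exact: (sub_dx hu).
- by move=> i; exact: (sub_dxx hu).
- by move=> z; rewrite lt_min => /andP[+ _]; exact: zmax.
Qed.

(** Maximum principle for the barrier [m + q |. - y|^2].  The power [u^p] is not
    Lipschitz at zero, but its monotonicity is enough: the hypothesis says that
    wherever [u] exceeds the barrier, the point is interior and the absorption
    is larger than [absorption_le_at_max] allows at a maximum of the difference. *)
Lemma comparison (D : set 'rV[R]_n) y (tau m q : R) :
  compact D -> D `<=` closure Omega -> tau < T ->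
  (forall x, D x -> 0 <= m + q * dot (x - y) (x - y)) ->
  (forall x t, D x -> 0 <= t <= tau -> m + q * dot (x - y) (x - y) < u x t ->
    [/\ Omega x, exists2 d, 0 < d & forall z, `|z - x| < d -> D z &
      2 * n%:R * q < c1 * u x t `^ p]) ->
  forall x t, D x -> 0 <= t <= tau -> u x t <= m + q * dot (x - y) (x - y).
Proof.
move=> Dc DO tauT v0 H x t Dx ttau.
pose f (z : 'rV[R]_n * R) := u z.1 z.2 - q * dot (z.1 - y) (z.1 - y).
pose K := D `*` `[0, tau]%classic.
have Kc : compact K by apply: compact_setX => //; exact: segment_compact.
have Kxt : K (x, t) by split=> //=; rewrite in_itv.
have fc : {within K, continuous f}.
  move=> z; apply: cvgB; last first.
    apply: (@continuous_subspaceT _ _ _ (fun z : 'rV[R]_n * R =>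
      q * dot (z.1 - y) (z.1 - y))) => {}z.
    exact: continuous_quadratic.
  apply: continuous_subspaceW (sub_cont hu) z => -[z s] [/= Dz].
  rewrite in_itv/= => /andP[s0 stau]; split; first exact: DO.
  by rewrite /= in_itv/= s0 (le_lt_trans stau).
have [[x1 t1]] := compact_EVT_max (ex_intro _ _ Kxt) Kc fc.
rewrite inE => -[/= Dx1]; rewrite in_itv/= => t1tau fmax.
have ftx := fmax _ (mem_set Kxt).
have [|lt1] := leP (u x1 t1) (m + q * dot (x1 - y) (x1 - y)).
  by move=> ule; move: ftx; rewrite /f/=; lra.
have [Ox1 [d d0 Dd]] := H _ _ Dx1 t1tau lt1.
rewrite ltNge => /negP; case.
have /andP[t10 t1t] := t1tau.
have t1p : 0 < t1.
  rewrite lt_neqAle t10 andbT; apply/eqP => t1E.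
  by move: lt1; rewrite -t1E (sub_init hu) ?ltNge ?v0//; exact: DO.
apply: (@absorption_le_at_max x1 t1 y q (Num.min d t1)) => //.
- by rewrite t1p (le_lt_trans t1t).
- by rewrite lt_min d0.
- move=> z; rewrite lt_min => /andP[/Dd Dz _].
  have /mem_set/fmax : K (z, t1) by split=> //=; rewrite in_itv.
  by [].
- move=> s sd st1.
  have /mem_set/fmax : K (x1, s).
    split=> //=; rewrite in_itv/= (le_trans st1)// andbT.
    have : Num.min d t1 <= t1 by rewrite ge_min lexx orbT.
    lra.
  by rewrite /f/= lerD2r.
Qed.

End reaction_diffusion.

(** * Vanishing deep inside the domain *)

Section rates.
Context {R : realType}.
Variables (n : nat) (p c1 : R).
Hypotheses (hn : (0 < n)%N) (hp : 0 < p < 1) (hc : 0 < c1).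

(** Opening of the paraboloids used at height [M]: their Laplacian is the
    absorption at height [M / 2]. *)
Definition curvature (M : R) : R := c1 * (M / 2) `^ p / (2 * n%:R).

(** The radius over which a paraboloid of that opening climbs by [M / 2]. *)
Definition core_width (M : R) : R := Num.sqrt (M / 2 / curvature M).

(** The factor [2^((p - 1) / 2)] by which [core_width] shrinks when the height is
    halved, written with a square root to match [core_width]. *)
Definition core_ratio : R := Num.sqrt (2^-1 / 2^-1 `^ p).

Let n0 : 0 < n%:R :> R. Proof. by rewrite ltr0n. Qed.

Lemma curvature_gt0 M : 0 < M -> 0 < curvature M.
Proof. by move=> M0; rewrite !(divr_gt0,mulr_gt0)// powR_gt0// divr_gt0. Qed.

Lemma curvatureE M : 2 * n%:R * curvature M = c1 * (M / 2) `^ p.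
Proof. by rewrite /curvature mulrC divfK// mulf_neq0 ?pnatr_eq0 -?lt0n. Qed.

Lemma core_width_gt0 M : 0 < M -> 0 < core_width M.
Proof.
move=> M0; rewrite sqrtr_gt0.
by apply: divr_gt0; [exact: divr_gt0|exact: curvature_gt0].
Qed.

Lemma curvature_width M : 0 < M -> curvature M * core_width M ^+ 2 = M / 2.
Proof.
move=> M0; have q0 := curvature_gt0 M0.
rewrite sqr_sqrtr; last by apply: divr_ge0; [exact/ltW/divr_gt0|exact: ltW].
by rewrite mulrC divfK// gt_eqF.
Qed.

Lemma core_width_half M : 0 < M -> core_width (M / 2) = core_width M * core_ratio.
Proof.
move=> M0; rewrite /core_width /core_ratio -sqrtrM; last first.
  by apply: divr_ge0; [exact/ltW/divr_gt0|exact/ltW/curvature_gt0].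
congr Num.sqrt; rewrite /curvature [(M / 2 / 2) `^ p]powRM ?invr_ge0//; last first.
  by rewrite divr_ge0// ltW.
have h0 : 2^-1 `^ p != 0 :> R by rewrite gt_eqF// powR_gt0// invr_gt0.
have h1 : (M / 2) `^ p != 0 :> R by rewrite gt_eqF// powR_gt0// divr_gt0.
have h2 : n%:R != 0 :> R by rewrite gt_eqF.
have h3 : c1 != 0 by rewrite gt_eqF.
by field; rewrite h0 h1 h2 h3.
Qed.

Lemma core_width_exp M k : 0 < M ->
  core_width (M / 2 ^+ k) = core_width M * core_ratio ^+ k.
Proof.
move=> M0; elim: k => [|k IH]; first by rewrite !expr0 divr1 mulr1.
have Mk : 0 < M / 2 ^+ k by rewrite divr_gt0// exprn_gt0.
by rewrite exprSr invfM mulrA core_width_half// IH exprSr mulrA.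
Qed.

Lemma core_ratio_ge0 : 0 <= core_ratio. Proof. exact: sqrtr_ge0. Qed.

(** This is where absorption with [p < 1] is strong: the radii for the heights
    [M / 2 ^ k] are summable. *)
Lemma core_ratio_lt1 : core_ratio < 1.
Proof.
have /andP[p0 p1] := hp.
have h0 : 0 < 2^-1 `^ p :> R by rewrite powR_gt0// invr_gt0.
rewrite -sqrtr1 ltr_sqrt// ltr_pdivrMr// mul1r.
have E : 2^-1 = 2^-1 `^ p * 2^-1 `^ (1 - p) :> R.
  rewrite -powRD; last by rewrite invr_neq0// implybT.
  by rewrite addrC subrK powRr1// invr_ge0.
rewrite [ltLHS]E gtr_pMr// -[ltRHS](_ : 1 `^ (1 - p) = 1); last by rewrite powR1.
by rewrite gt0_ltr_powR ?subr_gt0 ?nnegrE ?invr_ge0// invf_lt1// ltr1n.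
Qed.

End rates.

Lemma compact_closed_ball_rV {R : realType} n (x : 'rV[R]_n) (r : R) :
  compact (closed_ball_ Num.norm x r).
Proof.
apply: bounded_closed_compact; last exact: closed_closed_ball_.
exists (`|x| + r); split; first exact: num_real.
move=> M ltM z /= xz; rewrite -(subrK x z).
apply: le_trans (ler_normD _ _) _; rewrite distrC addrC ltW//.
by rewrite (le_lt_trans _ ltM)// lerD2l.
Qed.

Section dead_core.
Context {R : realType} {n : nat}.
Variables (Omega : set 'rV[R]_n) (T p c1 : R) (u : 'rV[R]_n -> R -> R).
Hypothesis hn : (0 < n)%N.
Hypothesis hu : absorption_subsolution Omega T p c1 u.
Variable tau : R.
Hypothesis tauT : tau < T.
Implicit Types (M r : R).

Local Notation q := (curvature n p c1).
Local Notation s := (core_width n p c1).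

Let hp := sub_exponent hu.
Let hc := sub_rate hu.

Lemma absorption_dominates M b : 0 < M -> M / 2 < b ->
  2 * n%:R * q M < c1 * b `^ p.
Proof.
move=> M0 Mb; rewrite curvatureE// ltr_pM2l//.
have /andP[p0 _] := hp.
by rewrite gt0_ltr_powR// nnegrE ltW// ?divr_gt0// (lt_trans _ Mb)// divr_gt0.
Qed.

(** Depth is measured with closed balls, so that at radius [0] the deep points
    are exactly the points of the domain. *)
Definition deep r : set 'rV[R]_n := [set x | forall z, `|z - x| <= r -> Omega z].

Lemma deep_in r x : 0 <= r -> deep r x -> Omega x.
Proof. by move=> r0; apply; rewrite subrr normr0. Qed.

Lemma deepW r r' : r <= r' -> deep r' `<=` deep r.
Proof. by move=> rr x dx z /le_trans/(_ rr); exact: dx. Qed.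

(** Barrier: the paraboloid with vertex [x] and height [M / 2] there.  On the
    sup-norm sphere of radius [core_width M] it is at least [M], because the
    Euclidean norm dominates the sup norm; so [u] can exceed it only inside, and
    only at heights above [M / 2]. *)
Lemma halving M r : 0 < M -> 0 <= r ->
  (forall x t, deep r x -> 0 <= t <= tau -> u x t <= M) ->
  forall x t, deep (r + s M) x -> 0 <= t <= tau -> u x t <= M / 2.
Proof.
move=> M0 r0 uM x t dx tI.
have s0 : 0 < s M by exact: core_width_gt0.
have q0 : 0 < q M by exact: curvature_gt0.
have Dd z : `|z - x| <= s M -> deep r z.
  move=> zx w wz; apply: dx; rewrite -(subrKA z) (le_trans (ler_normD _ _))//.
  exact: lerD.
have := @comparison _ _ _ _ _ _ _ hu (closed_ball_ Num.norm x (s M)) x tau (M / 2) (q M)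
  (@compact_closed_ball_rV _ _ x (s M)) _ tauT _ _ x t.
rewrite subrr [dot 0 0](_ : _ = 0) ?mulr0 ?addr0; last first.
  by rewrite /dot big1// => i _; rewrite mxE mul0r.
apply=> //.
- move=> z; rewrite /closed_ball_/= distrC => /Dd dz.
  exact/subset_closure/(deep_in r0).
- move=> z _; apply: addr_ge0; first exact/ltW/divr_gt0.
  exact: mulr_ge0 (ltW q0) (dot_ge0 _).
- move=> z t' Dz t'I uz; have := Dz; rewrite /closed_ball_/= distrC => zx.
  have dz := Dd _ zx; split; first exact: (deep_in r0).
    exists (s M - `|z - x|); last first.
      move=> w wz; rewrite /= -(subrKA z) (le_trans (ler_normD _ _))//.
      by rewrite distrC addrC [`|z - w|]distrC; lra.
    rewrite subr_gt0 lt_neqAle zx andbT; apply/eqP => zxE.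
    have := uM _ _ dz t'I; rewrite leNgt => /negP; apply.
    apply: le_lt_trans uz.
    have := sqr_norm_le_dot (z - x); rewrite zxE -(ler_pM2l q0) curvature_width//.
    lra.
  apply: absorption_dominates => //; apply: le_lt_trans uz.
  by rewrite lerDl mulr_ge0 ?dot_ge0// ltW.
- by rewrite /closed_ball_/= subrr normr0 ltW.
Qed.

(** Sum of the geometric series of radii [core_width (M / 2 ^ k)]. *)
Definition core_depth M := s M / (1 - core_ratio p).

(** [halving] is iterated: after [k] steps, [u] is at most [M / 2 ^ k] at the
    depth given by the sum of the first [k] radii.  All these depths stay below
    [core_depth M], where [k] can therefore tend to infinity. *)
Lemma dead_core M : 0 < M ->
  (forall x t, Omega x -> 0 <= t <= tau -> u x t <= M) ->
  forall x t, deep (core_depth M) x -> 0 <= t <= tau -> u x t <= 0.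
Proof.
move=> M0 uM x t dx tI.
have s0 : 0 < s M by exact: core_width_gt0.
have th0 := core_ratio_ge0 p; have th1 := core_ratio_lt1 hp.
(* the sum of the first [k] radii *)
pose rk k := s M * ((1 - core_ratio p ^+ k) / (1 - core_ratio p)).
have M2k k : 0 < M / 2 ^+ k by rewrite divr_gt0// exprn_gt0.
have sk k : s (M / 2 ^+ k) = s M * core_ratio p ^+ k by exact: core_width_exp.
have omk k : 0 <= (1 - core_ratio p ^+ k) / (1 - core_ratio p).
  by rewrite divr_ge0 ?subr_ge0 ?exprn_ile1// ltW.
have H k : forall x t, deep (rk k) x -> 0 <= t <= tau -> u x t <= M / 2 ^+ k.
  elim: k => [|k IH] z t' dz t'I.
    rewrite expr0 divr1; apply: uM => //; apply: deep_in dz.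
    by rewrite /rk mulr_ge0// ltW.
  rewrite exprSr invfM mulrA; apply: (@halving (M / 2 ^+ k) (rk k)) => //.
    by rewrite /rk mulr_ge0// ltW.
  apply: deepW dz; rewrite sk /rk -mulrDr ler_pM2l//.
  rewrite exprSr -subr_ge0 le_eqVlt; apply/orP; left; apply/eqP.
  by field; rewrite subr_eq0 gt_eqF.
have {}H k : u x t <= M / 2 ^+ k.
  apply: H => //; apply: deepW dx; rewrite /rk /core_depth ler_pM2l//.
  by rewrite ler_pdivrMr ?subr_gt0// mulVf ?subr_eq0 ?gt_eqF// gerBl exprn_ge0.
rewrite leNgt; apply/negP => u0.
have := archi_boundP (ltW (divr_gt0 M0 u0)).
set k := Num.bound _; rewrite ltNge => /negP; apply.
rewrite ler_pdivlMr//.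
have := H k; rewrite ler_pdivlMr ?exprn_gt0// => /(le_trans _); apply.
rewrite mulrC ler_pM2l// -natrX ler_nat.
by rewrite ltnW// ltn_expl.
Qed.

End dead_core.

(** * The normal derivative at a boundary maximum *)

Lemma continuous_dotl {R : realType} {n : nat} (v : 'rV[R]_n) :
  continuous (fun w => dot w v).
Proof.
move=> z; apply: (cvg_big add_continuous (nbhs_filter z)) => i _.
exact: (continuousM (@coord_continuous _ _ _ 0 i z) (@cst_continuous _ _ (v 0 i) z)).
Qed.

Section boundary_slope.
Context {R : realType} {n : nat}.
Variables (Omega : set 'rV[R]_n) (T p c1 : R) (u : 'rV[R]_n -> R -> R).
Hypothesis hn : (0 < n)%N.
Hypothesis hu : absorption_subsolution Omega T p c1 u.

Local Notation q := (curvature n p c1).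
Local Notation s := (core_width n p c1).

Let hp := sub_exponent hu.
Let hc := sub_rate hu.

(** The closed ball of centre [x - r nu] and radius [r], apart from its point
    [x], lies in the domain; [w] is the displacement from [x], and for a unit
    vector [nu] the inequality says that [w + x] is in that ball.  Closedness
    keeps the barrier region inside the closure of the domain. *)
Definition interior_ball (x nu : 'rV[R]_n) (r : R) : Prop :=
  forall w, w != 0 -> dot w w <= - (2 * r * dot nu w) -> Omega (w + x).

Lemma interior_ball_sphere (x nu : 'rV[R]_n) (r : R) z : dot nu nu = 1 ->
  dot (z - (x - r *: nu)) (z - (x - r *: nu)) =
  dot (z - x) (z - x) + 2 * r * dot nu (z - x) + r ^+ 2.
Proof.
move=> nu1; rewrite opprB addrCA addrC [_ - x + _]addrC dot_line nu1; ring.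
Qed.

(** Barrier: [M - q (s^2 - |. - y|^2)] on the tangent ball of radius
    [s = core_width M] and centre [y].  It equals [M] on the sphere and [M / 2]
    at the centre.  Along the inner normal at [x0] it is
    [M - q h (2 s - h)]. *)
Lemma below_barrier (x0 nu : 'rV[R]_n) M t : dot nu nu = 1 -> closure Omega x0 ->
  interior_ball x0 nu (s M) -> 0 < M -> 0 < t < T ->
  (forall x t', closure Omega x -> 0 <= t' <= t -> u x t' <= M) ->
  forall h, 0 <= h <= 2 * s M ->
    u (h *: - nu + x0) t <= M - q M * (h * (2 * s M - h)).
Proof.
move=> nu1 x0O ball M0 /andP[t0 tT] uM h /andP[h0 hs].
have s0 : 0 < s M by exact: core_width_gt0.
have q0 : 0 < q M by exact: curvature_gt0.
have qs : q M * s M ^+ 2 = M / 2 by exact: curvature_width.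
pose y := x0 - s M *: nu.
pose D := [set z | dot (z - y) (z - y) <= s M ^+ 2].
have DE z : D z -> z != x0 -> Omega z.
  rewrite /D/= interior_ball_sphere// => Dz zx0.
  rewrite -(subrK x0 z); apply: ball; first by rewrite subr_eq0.
  by lra.
have DO : D `<=` closure Omega.
  move=> z Dz; have [->//|zx0] := eqVneq z x0.
  exact/subset_closure/DE.
have Dcomp : compact D.
  apply: (@subclosed_compact _ _ (closed_ball_ Num.norm y (s M))).
  - rewrite (_ : D = (fun z => dot (z - y) (z - y)) @^-1` [set r | r <= s M ^+ 2])//.
    apply: (preimage_closed _ (@closed_le _ _)) => z _.
    exact: continuous_dot_sub.
  - exact: compact_closed_ball_rV.
  - move=> z Dz; rewrite /closed_ball_/= distrC -ler_sqr ?nnegrE ?(ltW s0)//.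
    exact: le_trans (sqr_norm_le_dot _) Dz.
have hD : dot (h *: - nu + x0 - y) (h *: - nu + x0 - y) = (s M - h) ^+ 2.
  have -> : h *: - nu + x0 - y = (s M - h) *: nu.
    by rewrite /y; apply/rowP => j; rewrite !mxE; ring.
  by rewrite dotZl dotZr nu1 mulr1 expr2.
have := @comparison _ _ _ _ _ _ _ hu D y t (M / 2) (q M)
  Dcomp DO tT _ _ (h *: - nu + x0) t.
rewrite hD => H; apply: le_trans (H _ _ _ _) _.
- move=> z _; apply: addr_ge0; first exact/ltW/divr_gt0.
  exact: mulr_ge0 (ltW q0) (dot_ge0 _).
- move=> z t' Dz t'I uz.
  have zs : dot (z - y) (z - y) < s M ^+ 2.
    rewrite lt_neqAle Dz andbT; apply/eqP => zE.
    move: uz; rewrite zE qs -splitr ltNge => /negP; apply.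
    by apply: uM => //; exact: DO.
  split.
  + apply: DE => //; apply/eqP => zx0; move: zs.
    have dot0 w : dot w 0 = 0 :> R by rewrite /dot big1// => k _; rewrite mxE mulr0.
    by rewrite zx0 interior_ball_sphere// subrr !dot0 mulr0 !add0r ltxx.
  + have /cvgrPdist_lt := @continuous_dot_sub _ _ y z.
    move=> /(_ (s M ^+ 2 - dot (z - y) (z - y))); rewrite subr_gt0 => /(_ zs).
    move=> /nbhs_ballP[d /= d0 Hd]; exists d => // z' z'z.
    have := Hd z'; rewrite -ball_normE/= distrC => /(_ z'z).
    by rewrite distrC => /(le_lt_trans (ler_norm _)); rewrite ltrD2r => /ltW.
  + apply: (absorption_dominates hn hu) => //; apply: le_lt_trans uz.
    by rewrite lerDl mulr_ge0 ?dot_ge0// ltW.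
- rewrite /D/= hD -subr_ge0 (_ : _ - _ = h * (2 * s M - h)); last by ring.
  by rewrite mulr_ge0// subr_ge0.
- by rewrite (ltW t0) lexx.
- by rewrite le_eqVlt; apply/orP; left; apply/eqP; lra.
Qed.

(** [u] equals the barrier of [below_barrier] at [x0] and stays below it along
    the inner normal.  The difference quotients are values of the gradient at
    nearby interior points, and the continuous extension [G] passes the bound to
    the boundary. *)
Lemma boundary_slope (x0 nu : 'rV[R]_n) M t (G : 'rV[R]_n -> 'rV[R]_n) :
  dot nu nu = 1 -> closure Omega x0 ->
  interior_ball x0 nu (s M) -> 0 < M -> 0 < t < T ->
  (forall x t', closure Omega x -> 0 <= t' <= t -> u x t' <= M) ->
  u x0 t = M ->
  {within closure Omega, continuous G} ->
  (forall x, Omega x -> gradient (u^~ t) x = G x) ->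
  2 * q M * s M <= dot (G x0) nu.
Proof.
move=> nu1 x0O ball M0 tI uM ux0 Gc Ggrad; have /andP[t0 tT] := tI.
have s0 : 0 < s M by exact: core_width_gt0.
have q0 : 0 < q M by exact: curvature_gt0.
have nu_norm : `|nu| <= 1.
  by rewrite -(@ler_pXn2r _ 2)// ?nnegrE// expr1n -nu1 sqr_norm_le_dot.
have OC : Omega `<=` closure Omega by exact: subset_closure.
have inO h : 0 < h <= 2 * s M -> Omega (h *: - nu + x0).
  move=> /andP[h0 hs]; apply: ball.
    apply/eqP => /(congr1 (fun v => dot v v)) /eqP.
    rewrite dotZl dotZr dotNr dotC dotNr opprK nu1 mulr1.
    rewrite [dot 0 0]big1 => [|i _]; last by rewrite mxE mulr0.
    by rewrite mulf_eq0 orbb gt_eqF.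
  rewrite dotZl !dotZr !dotNr dotC dotNr opprK nu1.
  rewrite -subr_ge0 (_ : _ - _ = h * (2 * s M - h)); last by ring.
  by rewrite mulr_ge0 ?subr_ge0// ltW.
have Oo := sub_open hu.
have du x v : Omega x -> is_derive x v (u^~ t) (dot (G x) v).
  move=> Ox; rewrite -Ggrad//.
  have /nbhs_ballP[d /= d0 Hd] := open_nbhs_nbhs (conj Oo Ox).
  apply: (@C1_is_derive _ _ _ _ d d0).
    move=> z zx i; apply: (sub_dx hu) => //; apply: Hd.
    by rewrite -ball_normE /= distrC.
  move=> i; have GO : {for x, continuous (fun z => G z 0 i)}.
    have : {in Omega, continuous G}.
      rewrite -continuous_open_subspace//.
      exact: continuous_subspaceW Gc.
    move=> /(_ x (mem_set Ox)) Gx.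
    exact: (continuous_comp Gx (@coord_continuous _ _ _ 0 i _)).
  have E z : Omega z -> G z 0 i = partial i (u^~ t) z.
    by move=> Oz; rewrite -Ggrad// mxE.
  rewrite /prop_for /continuous_at -(E _ Ox); apply: cvg_trans GO.
  apply: near_eq_cvg; first exact: (nbhs_filter x).
  apply: (@filterS _ (nbhs x) _ _ _ _ (open_nbhs_nbhs (conj Oo Ox))) => z Oz.
  by rewrite -E.
have uc : {within closure Omega, continuous (u^~ t)}.
  have := fun h1 h2 => @within_continuous_precomp _ _ _ _ (closure Omega) _
    (fun z : 'rV[R]_n => (z, t)) h1 h2 (sub_cont hu).
  apply.
  - exact: continuous_pairr.
  - by move=> z Oz; split=> //=; rewrite in_itv/= tT ltW.
have slope h : 0 < h <= 2 * s M -> exists2 k, 0 < k < h &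
    q M * (2 * s M - h) <= dot (G (k *: - nu + x0)) nu.
  move=> /andP[h0 hs].
  pose phi k := u (k *: - nu + x0) t.
  have phid k : k \in `]0, h[%R -> is_derive k 1 phi (dot (G (k *: - nu + x0)) (- nu)).
    rewrite in_itv/= => /andP[k0 kh].
    have Ok : Omega (k *: - nu + x0) by apply: inO; rewrite k0 ltW// (lt_le_trans kh).
    have D := du _ (- nu) Ok.
    have := @is_derive_line _ _ (u^~ t) x0 (- nu) k.
    by rewrite (@derive_val _ _ _ _ _ _ _ D); apply; case: D.
  have phic : {within `[0, h], continuous phi}.
    have := fun h1 h2 => @within_continuous_precomp _ _ _ _ `[0, h]%classic _
      (fun k : R => k *: - nu + x0) h1 h2 uc.
    apply.
    - move=> k; apply: cvgD; last exact: cvg_cst.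
      by apply: cvgZr_tmp; exact: cvg_id.
    - move=> k /=; rewrite in_itv/= => /andP[k0 kh].
      have [->|kn0] := eqVneq k 0; first by rewrite scale0r add0r.
      by apply: OC; apply: inO; rewrite lt_neqAle eq_sym kn0 k0 (le_trans kh).
  have [k kI E] := MVT h0 phid phic.
  exists k; first by move: kI; rewrite in_itv.
  have hI : 0 <= h <= 2 * s M by rewrite ltW.
  have := below_barrier nu1 x0O ball M0 tI uM hI.
  move: E; rewrite /phi scale0r add0r ux0 subr0 dotNr => E ub.
  by rewrite -(ler_pM2r h0); lra.
rewrite leNgt; apply/negP => ltG.
pose e := (2 * q M * s M - dot (G x0) nu) / 2.
have e0 : 0 < e by rewrite divr_gt0// subr_gt0.
have Gnu : {within closure Omega, continuous (fun z => dot (G z) nu)}.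
  by move=> z; exact: (continuous_comp (Gc z) (@continuous_dotl _ _ nu _)).
have [d d0 Hd] := within_continuous_eps Gnu x0O e0.
pose h := Num.min (d / 2) (Num.min (s M) (e / q M)).
have h0 : 0 < h.
  by rewrite !lt_min s0 divr_gt0//=; exact: divr_gt0.
have hd : h <= d / 2 by rewrite ge_min lexx.
have hs : h <= s M by rewrite !ge_min lexx orbT.
have he : h <= e / q M by rewrite !ge_min lexx !orbT.
have hI : 0 < h <= 2 * s M by rewrite h0/=; lra.
have [k /andP[k0 kh]] := slope h hI.
have := Hd (k *: - nu + x0); rewrite addrK normrZ normrN gtr0_norm//.
have kd : k * `|nu| < d.
  apply: (@le_lt_trans _ _ (k * 1)); first by rewrite ler_pM2l.
  by rewrite mulr1; lra.
have kO : closure Omega (k *: - nu + x0).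
  by apply: OC; apply: inO; rewrite k0/=; lra.
move=> /(_ kO kd) /(le_lt_trans (ler_norm _)).
move: he; rewrite ler_pdivlMr// /e => he ltk gek.
move: gek; rewrite mulrBr [q M * h]mulrC mulrA => gek; lra.
Qed.

End boundary_slope.

(** * Boundary charts, normals and interior balls *)

Section compact_induction.
Context {R : realType} {V : normedModType R}.

(** A property of sets which is local, hereditary and stable under finite unions
    passes to compact sets; it turns the constants of one boundary chart into
    constants for the whole boundary. *)
Lemma compact_local_ind (K : set V) (P : set V -> Prop) : compact K ->
  P set0 -> (forall A B, P A -> P B -> P (A `|` B)) ->
  (forall A B, A `<=` B -> P B -> P A) ->
  (forall x, K x -> exists2 r, 0 < r & P [set y | `|y - x| < r]) -> P K.
Proof.
move=> Kc P0 PU PS Ploc.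
have /choice[r rP] (x : V) : exists r, K x -> 0 < r /\ P [set y | `|y - x| < r].
  have [Kx|nKx] := pselect (K x); last by exists 0.
  by have [r r0 Pr] := Ploc _ Kx; exists r => _; split.
pose f x := if `[< K x >] then [set y | `|y - x| < r x] else set0.
have fP x : P (f x).
  by rewrite /f; case: asboolP => [Kx|//]; have [] := rP _ Kx.
have fo x : K x -> open (f x).
  move=> Kx; rewrite /f; rewrite asboolT//.
  rewrite (_ : [set _ | _] = ball x (r x)).
    exact: ball_open.
  by apply/seteqP; split=> y /=; rewrite -ball_normE/= distrC.
have Kf : K `<=` cover K f.
  move=> x Kx; exists x => //; rewrite /f; rewrite asboolT//=.
  by rewrite subrr normr0; have [] := rP _ Kx.
move: Kc; rewrite compact_cover => /(_ V K f fo Kf)[D DK KD].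
apply: (PS _ _ KD); rewrite /cover bigcup_fset.
by elim/big_ind: _ => // A B PA PB; exact: PU.
Qed.

End compact_induction.

Section normals.
Context {R : realType} {n : nat}.
Implicit Types (x v w : 'rV[R]_n).

(** Moving from [x] in a direction along which [f1] decreases leads into
    [f1 < 0], hence into [f2 < 0]. *)
Lemma sublevel_gradient (f1 f2 : 'rV[R]_n -> R) x (G1 G2 : 'rV[R]_n) (d : R) v :
  0 < d -> is_derive x v f1 (dot G1 v) -> is_derive x v f2 (dot G2 v) ->
  f1 x = 0 -> f2 x = 0 ->
  (forall z, `|z - x| < d -> f1 z < 0 -> f2 z < 0) ->
  dot G1 v < 0 -> dot G2 v <= 0.
Proof.
move=> d0 [df1 D1] [df2 D2] f10 f20 f12 G1v; rewrite leNgt; apply/negP => G2v.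
have G1v' : 0 < - dot G1 v by rewrite oppr_gt0.
have [d1 d10 H1] := derive_eps df1 G1v'.
have [d2 d20 H2] := derive_eps df2 G2v.
have v0 : 0 < `|v| + 1 by rewrite ltr_wpDl.
pose h := Num.min (d / (`|v| + 1)) (Num.min d1 d2) / 2.
have m0 : 0 < Num.min (d / (`|v| + 1)) (Num.min d1 d2).
  by rewrite !lt_min d10 d20 !andbT divr_gt0.
have h0 : 0 < h by rewrite divr_gt0.
have : h < Num.min (d / (`|v| + 1)) (Num.min d1 d2).
  by rewrite /h ltr_pdivrMr// ltr_pMr// ltr1n.
rewrite !lt_min => /and3P[hd hd1 hd2].
have hn0 : h != 0 by rewrite gt_eqF.
have := H1 h hn0; have := H2 h hn0; rewrite gtr0_norm// D1 D2 f10 f20 !subr0.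
move=> /(_ hd2) A2 /(_ hd1) A1.
have {}A1 : h^-1 * f1 (h *: v + x) < 0.
  by move: A1; rewrite ltr_norml => /andP[_]; lra.
have {}A2 : 0 < h^-1 * f2 (h *: v + x).
  by move: A2; rewrite ltr_norml => /andP[+ _]; lra.
have := f12 (h *: v + x); rewrite addrK normrZ gtr0_norm//.
have -> : h * `|v| < d.
  move: hd; rewrite ltr_pdivlMr// => /(le_lt_trans _); apply.
  by rewrite ler_pM2l// lerDl.
move: A1 A2; rewrite pmulr_rlt0 ?invr_gt0// pmulr_rgt0 ?invr_gt0// => A1 A2.
by move=> /(_ isT A1); rewrite ltNge ltW.
Qed.

(** If [G] had a component [P] orthogonal to [nu], a large multiple of [-P] added
    to [nu] would still have inner product [1] with [nu], but a negative one with
    [G]. *)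
Lemma gradient_parallel (G nu : 'rV[R]_n) : G != 0 -> dot nu nu = 1 ->
  (forall v, dot G v < 0 -> dot nu v <= 0) ->
  exists2 lambda, 0 < lambda & G = lambda *: nu.
Proof.
move=> G0 nu1 H; pose lambda := dot G nu; pose P := G - lambda *: nu.
have Pnu : dot P nu = 0.
  by rewrite dotC /P dotBr dotZr nu1 mulr1 [dot nu G]dotC subrr.
have GP : dot G P = dot P P.
  have GE : G = lambda *: nu + P by rewrite /P addrC subrK.
  rewrite {1}GE.
  by rewrite dotDl dotZl dotC Pnu mulr0 add0r.
have P0 : P = 0.
  apply: dot_eq0; apply/eqP/negPn/negP => PP.
  have PP0 : 0 < dot P P by rewrite lt_neqAle eq_sym PP dot_ge0.
    (* [dot G P = dot P P], so this multiple makes [dot G v = -1] *)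
pose v := nu - ((lambda + 1) / dot P P) *: P.
  have : dot G v < 0.
    by rewrite /v dotBr dotZr GP divfK// -/lambda opprD addrA subrr add0r oppr_lt0.
  by move=> /H; rewrite /v dotBr dotZr [dot nu P]dotC Pnu mulr0 subr0 nu1 ler10.
have GE : G = lambda *: nu by apply/eqP; rewrite -subr_eq0 -/P P0.
exists lambda => //; rewrite lt_neqAle; apply/andP; split.
  by apply: contra_neq G0 => l0; rewrite GE -l0 scale0r.
by rewrite leNgt; apply/negP => /H; rewrite nu1 ler10.
Qed.

Lemma unit_normal_dot (Omega : set 'rV[R]_n) x nu :
  outward_unit_normal Omega x nu -> dot nu nu = 1.
Proof.
move=> [U [rho [Ux [_ _ g0 _ _] ->]]].
have := g0 _ Ux; set g := gradient rho x => gn0.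
have gg : 0 < dot g g.
  rewrite lt_neqAle dot_ge0 andbT eq_sym; apply: contra_neq gn0; exact: dot_eq0.
rewrite dotZl dotZr /euclidean_norm mulrA -expr2 exprVn sqr_sqrtr ?ltW//.
by rewrite mulVf// gt_eqF.
Qed.

End normals.

Section charts.
Context {R : realType} {n : nat}.
Variable Omega : set 'rV[R]_n.
Implicit Types (x z : 'rV[R]_n) (r eta L : R).

(** A defining function on a ball of radius [3 r], so that points within [r] of
    a boundary point in the ball of radius [r] leave a margin.  The partial
    derivative in the direction [i] does not vanish; [L] bounds the first and
    second derivatives. *)
Record boundary_chart x0 r (rho : 'rV[R]_n -> R) (i : 'I_n) eta L : Prop :=
  BoundaryChart {
  chart_r : 0 < r;
  chart_eta : 0 < eta;
  chart_L : 0 <= L;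
  chart_in : forall z, `|z - x0| <= 3 * r -> (Omega z <-> rho z < 0);
  chart_bd : forall z, `|z - x0| <= 3 * r -> (boundary Omega z <-> rho z = 0);
  chart_cont : forall z, `|z - x0| <= 3 * r -> {for z, continuous rho};
  chart_d : forall z k, `|z - x0| <= 3 * r -> derivable rho z (basis_vec k);
  chart_dd : forall z k m, `|z - x0| <= 3 * r ->
    derivable (partial k rho) z (basis_vec m);
  chart_dc : forall z k, `|z - x0| <= 3 * r -> {for z, continuous (partial k rho)};
  chart_di : forall z, `|z - x0| <= 3 * r -> eta <= `|partial i rho z|;
  chart_dL : forall z k, `|z - x0| <= 3 * r -> `|partial k rho z| <= L;
  chart_ddL : forall z k m, `|z - x0| <= 3 * r ->
    `|partial m (partial k rho) z| <= L }.

(** All requirements are open conditions at [x0]; [eta] is half of a nonzero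
    partial derivative at [x0], and [L] is a sum that exceeds each
    derivative there by at least one. *)
Lemma exists_chart x0 : smooth_boundary Omega -> boundary Omega x0 ->
  exists r rho i eta L, boundary_chart x0 r rho i eta L.
Proof.
move=> sm /sm[U [rho [Ux [Uo srho g0 UO Ubd]]]].
have [rc rC2] := srho 2%N.
have /existsNP[i /eqP gi] : ~ forall i, partial i rho x0 = 0.
  move=> H; have := g0 _ Ux; apply/negP; rewrite negbK; apply/eqP/rowP => i.
  by rewrite !mxE H.
pose eta := `|partial i rho x0| / 2.
have eta0 : 0 < eta by rewrite divr_gt0// normr_gt0.
pose A k := `|partial k rho x0| + 1.
pose B (k m : 'I_n) := `|partial m (partial k rho) x0| + 1.
pose L := \sum_k A k + \sum_k \sum_m B k m.
have A0 k : 0 <= A k by rewrite addr_ge0.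
have B0 k m : 0 <= B k m by rewrite addr_ge0.
have SB0 k : 0 <= \sum_m B k m by rewrite sumr_ge0.
have AL k : A k <= L.
  rewrite /L (bigD1 k)//= -addrA lerDl addr_ge0// sumr_ge0//.
have BL k m : B k m <= L.
  apply: (@le_trans _ _ (\sum_m B k m)).
    by rewrite (bigD1 m)//= lerDl sumr_ge0.
  apply: (@le_trans _ _ (\sum_k \sum_m B k m)).
    by rewrite [leRHS](bigD1 k)//= lerDl sumr_ge0.
  by rewrite lerDr sumr_ge0.
have L0 : 0 <= L by rewrite addr_ge0// sumr_ge0.
have close (f : 'rV[R]_n -> R) e : 0 < e -> {for x0, continuous f} ->
    \forall z \near x0, `|f z - f x0| < e.
  move=> e0 /cvgrPdist_lt/(_ _ e0).
  by apply: (@filterS _ (nbhs x0)) => z; rewrite distrC.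
have NU : \forall z \near x0, U z := open_nbhs_nbhs (conj Uo Ux).
have Ni := close _ _ eta0 ((rC2 i).2.1 _ Ux).
have Nk : \forall z \near x0, forall k, `|partial k rho z - partial k rho x0| < 1.
  apply: (@filter_forall _ _ (fun k z => `|partial k rho z - partial k rho x0| < 1)
    (nbhs x0) (nbhs_filter x0)) => k.
  exact: close (ltr01) ((rC2 k).2.1 _ Ux).
have Nkm : \forall z \near x0, forall km : 'I_n * 'I_n,
    `|partial km.2 (partial km.1 rho) z - partial km.2 (partial km.1 rho) x0| < 1.
  apply: (@filter_forall _ _ (fun km z => `|partial km.2 (partial km.1 rho) z
      - partial km.2 (partial km.1 rho) x0| < 1)
    (nbhs x0) (nbhs_filter x0)) => -[k m].
  exact: close (ltr01) (((rC2 k).2.2 m).2.1 _ Ux).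
have := @filterI _ _ (nbhs_filter x0) _ _ (@filterI _ _ (nbhs_filter x0) _ _ NU Ni)
  (@filterI _ _ (nbhs_filter x0) _ _ Nk Nkm).
move=> /nbhs_ballP[d /= d0 Hd].
have r0 : 0 < d / 4 by rewrite divr_gt0.
have {}Hd z : `|z - x0| <= 3 * (d / 4) -> [/\ U z,
    `|partial i rho z - partial i rho x0| < eta,
    forall k, `|partial k rho z - partial k rho x0| < 1 &
    forall k m, `|partial m (partial k rho) z - partial m (partial k rho) x0| < 1].
  move=> zx; have := Hd z; rewrite -ball_normE/= distrC.
  have zd : `|z - x0| < d by apply: le_lt_trans zx _; lra.
  by move=> /(_ zd)[[Uz zi] [zk zkm]]; split=> // k m; exact: (zkm (k, m)).
have shift1 (a b e : R) : `|a - b| < e -> `|a| <= `|b| + e.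
  by move=> ab; have := ler_normD (a - b) b; rewrite subrK; lra.
exists (d / 4), rho, i, eta, L; split => //.
- by move=> z /Hd[Uz _ _ _]; exact: UO.
- by move=> z /Hd[Uz _ _ _]; exact: Ubd.
- by move=> z /Hd[Uz _ _ _]; exact: rc.
- by move=> z k /Hd[Uz _ _ _]; exact: (rC2 k).1.
- by move=> z k m /Hd[Uz _ _ _]; exact: ((rC2 k).2.2 m).1.
- by move=> z k /Hd[Uz _ _ _]; exact: (rC2 k).2.1.
- move=> z /Hd[_ + _ _]; rewrite distrC => /shift1.
  by rewrite /eta; lra.
- by move=> z k /Hd[_ _ zk _]; have := shift1 _ _ _ (zk k) => /le_trans; apply; exact: AL.
- by move=> z k m /Hd[_ _ _ /(_ k m)/shift1] => /le_trans; apply; exact: BL.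
Qed.

Lemma partial_lipschitz (f : 'rV[R]_n -> R) x (w : 'rV[R]_n) L :
  (forall z k, `|z - x| <= `|w| -> derivable f z (basis_vec k)) ->
  (forall z k, `|z - x| <= `|w| -> `|partial k f z| <= L) ->
  `|f (w + x) - f x| <= n%:R * L * `|w|.
Proof.
move=> fd fL.
have [z zx ->] := partial_increment (fun z zx k => fd z k zx).
apply: le_trans (ler_norm_sum _ _ _) _.
apply: (@le_trans _ _ (\sum_(k < n) L * `|w|)).
  apply: ler_sum => k _; rewrite normrM mulrC ler_pM//; first exact: fL.
  exact: rV_norm_coord.
by rewrite sumr_const card_ord -mulrA mulr_natl.
Qed.

Lemma le_dist_add x y z (a b c : R) : `|z - y| <= a -> `|y - x| <= b -> a + b <= c ->
  `|z - x| <= c.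
Proof.
move=> za yb abc; rewrite -(subrKA y); apply: le_trans (ler_normD _ _) _.
by apply: le_trans abc; exact: lerD.
Qed.

Section chart.
Variables (x0 : 'rV[R]_n) (r : R) (rho : 'rV[R]_n -> R) (i : 'I_n) (eta L : R).
Hypothesis hch : boundary_chart x0 r rho i eta L.

Lemma chart_is_derive x v : `|x - x0| <= 2 * r ->
  is_derive x v rho (dot (gradient rho x) v).
Proof.
have r0 := chart_r hch.
move=> xx0.
apply: (@C1_is_derive _ _ _ _ _ r0) => [z zx k|k].
  apply: (chart_d hch); apply: (le_dist_add (ltW zx) xx0); lra.
apply: (chart_dc hch); apply: le_trans xx0 _; lra.
Qed.

Definition chart_hessian_bound : R := n%:R * (n%:R * L).

Lemma chart_hessian_bound_ge0 : 0 <= chart_hessian_bound.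
Proof. by have L0 := chart_L hch; rewrite !mulr_ge0. Qed.

Lemma chart_taylor x (w : 'rV[R]_n) : `|x - x0| <= r -> `|w| <= r ->
  rho (w + x) <= rho x + dot (gradient rho x) w + chart_hessian_bound * dot w w.
Proof.
have r0 := chart_r hch; have L0 := chart_L hch.
move=> xx0 wr.
have near h : 0 <= h <= 1 -> `|h *: w| <= `|w|.
  by move=> /andP[h0 h1]; rewrite normrZ ger0_norm// ler_piMl.
have near2 h : 0 <= h <= 1 -> `|h *: w + x - x0| <= 2 * r.
  move=> hI; apply: (@le_dist_add _ x _ r r) => //; last lra.
  by rewrite addrK (le_trans (near _ hI)).
have rd h : 0 <= h <= 1 -> derivable rho ((h * 1) *: w + x) w.
  by move=> hI; rewrite mulr1; have [] := chart_is_derive w (near2 _ hI).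
have [h hI] := mvt_line rd.
rewrite mulr1 scale1r mul1r (@derive_val _ _ _ _ _ _ _ (chart_is_derive w (near2 _ hI))).
move=> /eqP; rewrite subr_eq => /eqP ->; rewrite addrC -addrA lerD2l.
rewrite -lerBlDl -[dot (gradient rho x) w]dotC -[dot _ w]dotC -dotBr.
apply: le_trans (ler_norm _) _; apply: le_trans (dot_le _ _) _.
have gd : `|gradient rho (h *: w + x) - gradient rho x| <= n%:R * L * `|w|.
  apply: le_rV_norm => [|k]; first by rewrite !mulr_ge0.
  rewrite !mxE; apply: le_trans (@partial_lipschitz _ x (h *: w) L _ _) _.
  - move=> z k' zx; apply: (chart_dd hch); apply: (@le_dist_add _ x _ r r) => //; last lra.
    by rewrite (le_trans zx)// (le_trans (near _ hI)).
  - move=> z k' zx; apply: (chart_ddL hch); apply: (@le_dist_add _ x _ r r) => //; last lra.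
    by rewrite (le_trans zx)// (le_trans (near _ hI)).
  - by rewrite ler_wpM2l ?near// mulr_ge0.
apply: (@le_trans _ _ (n%:R * (`|w| * (n%:R * L * `|w|)))).
  by rewrite ler_wpM2l// ler_wpM2l.
have E a : n%:R * (a * (n%:R * L * a)) = chart_hessian_bound * a ^+ 2.
  by rewrite /chart_hessian_bound; ring.
rewrite E.
by rewrite ler_wpM2l ?chart_hessian_bound_ge0// sqr_norm_le_dot.
Qed.

(** The prescribed normal comes from some defining function, not from the chart.
    Both have the same negative set near [x], so their gradients are parallel,
    with a factor that the chart bounds from below. *)
Lemma chart_normal x nu : `|x - x0| <= r -> boundary Omega x ->
  outward_unit_normal Omega x nu ->
  exists2 lambda, eta <= lambda & gradient rho x = lambda *: nu.
Proof.
have r0 := chart_r hch.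
move=> xx0 bx hnu; have nu1 := unit_normal_dot hnu.
move: hnu => [U [rho' [Ux [Uo srho g0 UO Ubd]] nuE]].
have g'0 := g0 _ Ux; set g' := gradient rho' x in g'0 nuE.
have eg : 0 < (euclidean_norm g')^-1.
  rewrite invr_gt0 sqrtr_gt0 lt_neqAle dot_ge0 andbT eq_sym.
  by apply: contra_neq g'0; exact: dot_eq0.
have /nbhs_ballP[d /= d0 Hd] := open_nbhs_nbhs (conj Uo Ux).
have [_ rC1] := srho 1%N.
have xx0' : `|x - x0| <= 3 * r by apply: le_trans xx0 _; lra.
have d' v : is_derive x v rho' (dot g' v).
  apply: (@C1_is_derive _ _ _ _ d d0) => [z zx k|k].
    by apply: (rC1 k).1; apply: Hd; rewrite -ball_normE/= distrC.
  exact: (rC1 k).2.1.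
have gn0 : gradient rho x != 0.
  apply/eqP => /rowP/(_ i); rewrite !mxE => gi0.
  have := chart_di hch xx0'; rewrite gi0 normr0 leNgt => /negP; apply.
  exact: chart_eta hch.
have m0 : 0 < Num.min d r by rewrite lt_min d0.
have [lambda l0 gE] : exists2 lambda, 0 < lambda & gradient rho x = lambda *: nu.
  apply: gradient_parallel => // v gv.
  rewrite nuE dotZl pmulr_rle0//.
  have xx2 : `|x - x0| <= 2 * r by apply: le_trans xx0 _; lra.
  apply: (sublevel_gradient m0 (chart_is_derive v xx2) (d' v)) => //.
  - by apply/(chart_bd hch).
  - by apply/Ubd.
  - move=> z; rewrite lt_min => /andP[zd zr] rz.
    apply/UO; first by apply: Hd; rewrite -ball_normE/= distrC.
    apply/(chart_in hch) => //; apply: (le_dist_add (ltW zr) xx0); lra.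
exists lambda => //.
have le : eta ^+ 2 <= lambda ^+ 2.
  have -> : lambda ^+ 2 = dot (gradient rho x) (gradient rho x).
    by rewrite gE dotZl dotZr nu1 mulr1.
  apply: le_trans (sqr_coord_le_dot _ i); rewrite mxE.
  rewrite -[leRHS]real_normK ?num_real// ler_sqr ?nnegrE ?(ltW (chart_eta hch))//.
  exact: chart_di hch _ xx0'.
by move: le; rewrite ler_sqr// nnegrE ltW// (chart_eta hch).
Qed.

(** Small enough for the tangent ball to stay in the chart, and for the slope
    [eta] to dominate the second order term. *)
Definition chart_radius : R :=
  Num.min (r / 2) (eta / (2 * chart_hessian_bound + 1)).

Lemma chart_radius_gt0 : 0 < chart_radius.
Proof.
have r0 := chart_r hch; have K0 := chart_hessian_bound_ge0.
rewrite lt_min divr_gt0//= divr_gt0 ?(chart_eta hch)//; lra.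
Qed.

(** For [w] in the tangent ball of radius [s], the slope term of the expansion
    [chart_taylor] is at most [- lambda |w|^2 / (2 s)], which beats the quadratic
    remainder when [s] is at most [chart_radius]. *)
Lemma chart_interior_ball x nu s : `|x - x0| <= r -> boundary Omega x ->
  outward_unit_normal Omega x nu -> 0 < s <= chart_radius ->
  interior_ball Omega x nu s.
Proof.
move=> xx0 bx hnu /andP[s0]; rewrite le_min => /andP[sr sK] w w0 wball.
have r0 := chart_r hch; have K0 := chart_hessian_bound_ge0.
have nu1 := unit_normal_dot hnu.
have [lambda le gE] := chart_normal xx0 bx hnu.
have ww0 : 0 < dot w w.
  by rewrite lt_neqAle dot_ge0 andbT eq_sym; apply: contra_neq w0; exact: dot_eq0.
(* [|w + 2 s nu|^2 >= 0] bounds [- 2 s (nu . w)] by [|w|^2 / 2 + 2 s^2] *)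
have w2 : dot w w <= (2 * s) ^+ 2.
  have := dot_ge0 ((2 * s) *: nu + w); rewrite dot_line nu1.
  by move: wball; rewrite !mulrDr expr2; lra.
have wr : `|w| <= r.
  apply: (@le_trans _ _ (2 * s)); last lra.
  rewrite -ler_sqr ?nnegrE// ?(le_trans (sqr_norm_le_dot _))//; lra.
have xx0' : `|x - x0| <= 3 * r by apply: le_trans xx0 _; lra.
have wx : `|w + x - x0| <= 3 * r.
  apply: (@le_dist_add _ x _ r r) => //; [by rewrite addrK|lra].
apply/(chart_in hch) => //; apply: le_lt_trans (chart_taylor xx0 wr) _.
have -> : rho x = 0 by apply/(chart_bd hch).
rewrite add0r gE dotZl.
have l0 : 0 < lambda := lt_le_trans (chart_eta hch) le.
have nuw : dot nu w <= - (dot w w / (2 * s)).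
  rewrite lerNr ler_pdivrMr ?mulr_gt0//; lra.
apply: (@le_lt_trans _ _ (lambda * - (dot w w / (2 * s)) + chart_hessian_bound * dot w w)).
  by rewrite lerD2r ler_pM2l.
have -> : lambda * - (dot w w / (2 * s)) + chart_hessian_bound * dot w w =
   (chart_hessian_bound * (2 * s) - lambda) * (dot w w / (2 * s)).
  by field; rewrite gt_eqF.
rewrite pmulr_llt0 ?divr_gt0 ?mulr_gt0// subr_lt0.
apply: lt_le_trans le.
move: sK; rewrite ler_pdivlMr; last lra.
lra.
Qed.

End chart.

End charts.

(** * Lebesgue measure of sets that are thin in one direction *)

Section integral_bound.
Context {d : measure_display} {T : measurableType d} {R : realType}.
Variable mu : {measure set T -> \bar R}.
Local Open Scope ereal_scope.

(** The integral of a nonnegative function is a supremum over simple functions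
    below it, so monotonicity holds for arbitrary [f]. *)
Lemma integral_le_indic (D S : set T) (f : T -> \bar R) (C : R) :
  measurable S -> (0 <= C)%R -> (forall x, D x -> 0 <= f x) ->
  (forall x, D x -> S x -> f x <= C%:E) ->
  (forall x, D x -> ~ S x -> f x = 0) ->
  \int[mu]_(x in D) f x <= C%:E * mu S.
Proof.
move=> mS C0 f0 fC fS.
rewrite -(setIT S) -(integral_indic mu measurableT mS) -ge0_integralZl//; last first.
  exact: measurableT_comp.
rewrite ge0_integralE// ge0_integralE; last first.
  by move=> x _; rewrite mule_ge0// lee_fin.
apply: ge_ereal_sup => _ [h /= hf <-]; apply: ereal_sup_ubound; exists h => //=.
move=> x; apply: le_trans (hf x) _; rewrite /patch in_setT; case: ifPn => [|_];
  last first.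
  by rewrite mule_ge0// lee_fin.
rewrite inE => Dx; rewrite indicE; case: (boolP (x \in S)) => [|/negP]; rewrite inE => Sx.
  by rewrite mule1; exact: fC.
by rewrite mule0 fS.
Qed.

End integral_bound.

Section tuple_measurability.
Context {R : realType}.
Local Notation mR := (measurableTypeR R).

(** An open set is the countable union of the boxes with rational centre and
    radius [1 / (k + 1)] that it contains. *)
Lemma measurable_row_of_tuple_open n (U : set 'rV[R]_n) : open U ->
  measurable (@row_of_tuple R n @^-1` U).
Proof.
move=> Uo.
pose box (qk : 'rV[rat]_n * nat) : set (n.-tuple mR) :=
  \bigcap_(i in [set: 'I_n]) ((@tnth n mR ^~ i) @^-1`
    ball (ratr (qk.1 0 i) : R) (qk.2.+1%:R^-1)).
have mbox qk : measurable (box qk).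
  apply: fin_bigcap_measurable => // i _.
  rewrite -[X in measurable X]setTI; apply: measurable_tnth => //.
  exact: measurable_ball.
pose F qk := if `[< box qk `<=` @row_of_tuple R n @^-1` U >] then box qk else set0.
rewrite (_ : _ @^-1` _ = \bigcup_qk F qk).
  apply: countable_bigcupT_measurable; first exact: countableP.
  by move=> qk; rewrite /F; case: ifP.
apply/seteqP; split=> t /=; last first.
  by move=> [qk _]; rewrite /F; case: asboolP => // H /H.
move=> Ut; have /nbhs_ballP[e /= e0 He] := open_nbhs_nbhs (conj Uo Ut).
have e20 : 0 < 2 / e by rewrite divr_gt0.
pose k := Num.bound (2 / e).
have tri0 (a K : R) : 0 < K -> a - K < a + K by lra.
have tri1 (a b K : R) : a - K < b -> b < a + K -> `|b - a| < K.
  by move=> ab ba; rewrite ltr_norml; apply/andP; split; lra.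
have tri2 (a b b' K : R) : `|a - b| < K -> `|a - b'| < K -> K < e / 2 ->
    `|b - b'| < e.
  rewrite !ltr_norml => /andP[a1 a2] /andP[b1 b2] Ke.
  by apply/andP; split; lra.
have k0 : 0 < k.+1%:R^-1 :> R by rewrite invr_gt0.
have ke : k.+1%:R^-1 < e / 2.
  rewrite -[e / 2]invrK ltf_pV2 ?posrE ?invr_gt0 ?divr_gt0// invf_div.
  apply: lt_trans (archi_boundP (ltW e20)) _; by rewrite ltr_nat.
have /choice[q Hq] (i : 'I_n) : exists q : rat,
    ball (ratr q : R) (k.+1%:R^-1) (tnth t i).
  move: (tnth t i : R) => a.
  have /rat_in_itvoo[q] : a - k.+1%:R^-1 < a + k.+1%:R^-1 by exact: tri0.
  rewrite in_itv/= => /andP[q1 q2]; exists q.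
  by rewrite -ball_normE/=; exact: tri1.
exists (\row_i q i, k) => //; rewrite /F asboolT.
  by move=> i _ /=; rewrite mxE; exact: Hq.
move=> t' bt' /=; apply: He; rewrite -ball_normE/=; apply: lt_rV_norm => // i.
rewrite !mxE; have := bt' i I; have := Hq i; rewrite /= mxE -!ball_normE/=.
by move=> tq t'q; exact: tri2 tq t'q ke.
Qed.

Lemma measurable_row_of_tuple_closed n (S : set 'rV[R]_n) : closed S ->
  measurable (@row_of_tuple R n @^-1` S).
Proof.
move=> Sc; rewrite -[S]setCK preimage_setC; apply: measurableC.
exact: (@measurable_row_of_tuple_open n _ (closed_openC Sc)).
Qed.

Local Open Scope ereal_scope.

Lemma lebesgue_itv_le (a r : R) : (0 <= r)%R ->
  lebesgue_measure (`[(a - r)%R, (a + r)%R]%classic : set mR) <= (2 * r)%:E.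
Proof.
move=> r0; rewrite lebesgue_measure_itv/=; case: ifP => _.
  by rewrite -EFinD lee_fin; lra.
by rewrite lee_fin mulr_ge0.
Qed.

Lemma lebesgue_measure_diameter (S : set mR) (h : R) : (0 <= h)%R ->
  measurable S -> (forall a b, S a -> S b -> (`|a - b| <= h)%R) ->
  lebesgue_measure S <= (2 * h)%:E.
Proof.
move=> h0 mS Sh; have [->|/set0P[a Sa]] := eqVneq S set0.
  by rewrite measure0 lee_fin mulr_ge0.
have SI : S `<=` `[(a - h)%R, (a + h)%R]%classic.
  move=> b Sb; have := Sh b a Sb Sa.
  by rewrite /= in_itv/= ler_distl.
apply: (@le_trans _ _ (lebesgue_measure (`[(a - h)%R, (a + h)%R]%classic : set mR))).
  by apply: le_measure => //; rewrite inE.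
exact: lebesgue_itv_le.
Qed.

Lemma lebesgue_tuple_consE n (A : set (n.+1.-tuple mR)) :
  lebesgue_tuple n.+1 A =
  (lebesgue_measure \x lebesgue_tuple n) (@cons_pair R n @^-1` A).
Proof. by []. Qed.

Definition tuple_box n (x0 : 'rV[R]_n) (r : R) : set (n.-tuple mR) :=
  [set t | forall i, (`|tnth t i - x0 0%R i| <= r)%R].

Lemma measurable_tuple_box n (x0 : 'rV[R]_n) (r : R) : measurable (tuple_box x0 r).
Proof.
rewrite (_ : tuple_box _ _ = \bigcap_(i in [set: 'I_n])
    ((@tnth n mR ^~ i) @^-1` `[(x0 0%R i - r)%R, (x0 0%R i + r)%R]%classic)).
  apply: fin_bigcap_measurable => // i _.
  by rewrite -[X in measurable X]setTI; apply: measurable_tnth.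
apply/seteqP; split=> t /= H i; first by move=> _; rewrite /= in_itv/= -ler_distl.
by have := H i I; rewrite /= in_itv/= -ler_distl.
Qed.

Lemma lebesgue_tuple_box n (x0 : 'rV[R]_n) (r : R) : (0 <= r)%R ->
  lebesgue_tuple n (tuple_box x0 r) <= ((2 * r) ^+ n)%:E.
Proof.
move=> r0; elim: n x0 => [|n IH] x0.
  by rewrite expr0; apply: probability_le1 => //; exact: measurable_tuple_box.
pose x1 : 'rV[R]_n := \row_i x0 0%R (lift ord0 i).
have E : @cons_pair R n @^-1` tuple_box x0 r =
    `[(x0 0%R ord0 - r)%R, (x0 0%R ord0 + r)%R]%classic `*` tuple_box x1 r.
  apply/seteqP; split=> -[a t] /=.
    move=> H; split; first by have := H ord0; rewrite in_itv/= -ler_distl tnth0.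
    by move=> i; have := H (lift ord0 i); rewrite tnthS mxE.
  rewrite in_itv/= -ler_distl => -[H1 H2] i.
  case: (unliftP ord0 i) => [j|] ->; first by rewrite tnthS; have := H2 j; rewrite mxE.
  by rewrite tnth0.
rewrite lebesgue_tuple_consE E product_measure1E//; last exact: measurable_tuple_box.
rewrite exprS EFinM; apply: lee_pmul; [exact: measure_ge0|exact: measure_ge0| |exact: IH].
exact: lebesgue_itv_le.
Qed.

(** Fubini, by induction on the dimension.  If the thin direction is the first
    coordinate, integrate over the others the length of the sections.
    Otherwise the sections at a fixed first coordinate are thin sets in one
    dimension less. *)
Lemma lebesgue_tuple_thin n (x0 : 'rV[R]_n) (r h : R) (i : 'I_n)
    (S : set (n.-tuple mR)) :
  (0 <= r)%R -> (0 <= h)%R -> measurable S -> S `<=` tuple_box x0 r ->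
  (forall t t', S t -> S t' -> (forall j, j != i -> tnth t j = tnth t' j) ->
    (`|tnth t i - tnth t' i| <= h)%R) ->
  lebesgue_tuple n S <= (2 * h * (2 * r) ^+ n.-1)%:E.
Proof.
move=> r0 h0; elim: n => [|n IH] in x0 i S *; first by case: i.
move=> mS Sbox Sthin.
pose A := @cons_pair R n @^-1` S.
have mA : measurable A.
  by rewrite -[A]setTI; apply: measurable_cons_pair.
pose x1 : 'rV[R]_n := \row_i x0 0%R (lift ord0 i).
have Abox a t : A (a, t) -> (`|a - x0 0%R ord0| <= r)%R /\ tuple_box x1 r t.
  move=> /Sbox H; split; first by have := H ord0; rewrite tnth0.
  by move=> k; have := H (lift ord0 k); rewrite tnthS mxE.
have C0 m : (0 <= 2 * h * (2 * r) ^+ m)%R by rewrite !mulr_ge0// exprn_ge0// mulr_ge0.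
rewrite lebesgue_tuple_consE -/A /=.
case: (unliftP ord0 i) => [j|] iE; rewrite {i}iE in Sthin *; last first.
  rewrite (@product_measure_unique _ _ _ _ _ _ _
    (lebesgue_measure \x^ lebesgue_tuple n)%E)//; last first.
    by move=> B1 B2 mB1 mB2; exact: product_measure2E.
  apply: (@le_trans _ _ ((2 * h)%:E * lebesgue_tuple n (tuple_box x1 r))); last first.
    by rewrite (EFinM (2 * h)%R ((2 * r) ^+ n)%R); apply: lee_wpmul2l;
      [rewrite lee_fin mulr_ge0|exact: lebesgue_tuple_box].
  apply: integral_le_indic.
  - exact: measurable_tuple_box.
  - by rewrite mulr_ge0.
  - by move=> t _; exact: measure_ge0.
  - move=> t _ _ /=; apply: lebesgue_measure_diameter => //.
      exact: measurable_ysection.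
    move=> a b /ysectionP Aa /ysectionP Ab.
    have := Sthin _ _ Aa Ab; rewrite !tnth0; apply=> k.
    by case: (unliftP ord0 k) => [k'|] ->; rewrite ?eqxx// !tnthS.
  - move=> t _ nt /=; rewrite (_ : ysection A t = set0) ?measure0//.
    by apply/seteqP; split=> // a /ysectionP/Abox[].
pose I0 := `[(x0 0%R ord0 - r)%R, (x0 0%R ord0 + r)%R]%classic : set mR.
apply: (@le_trans _ _ ((2 * h * (2 * r) ^+ n.-1)%:E * lebesgue_measure I0)); last first.
  apply: (@le_trans _ _ ((2 * h * (2 * r) ^+ n.-1)%:E * (2 * r)%:E)).
    by apply: lee_wpmul2l; [rewrite lee_fin|exact: lebesgue_itv_le].
  rewrite -EFinM lee_fin -[(2 * h * _ * _)%R]mulrA.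
  by rewrite -exprSr prednK// (leq_trans _ (ltn_ord j)).
apply: integral_le_indic.
- exact: measurable_itv.
- exact: C0.
- by move=> a _; exact: measure_ge0.
- move=> a _ _ /=; apply: (IH x1 j) => //.
  + exact: measurable_xsection.
  + by move=> t /xsectionP/Abox[].
  + move=> t t' /xsectionP St /xsectionP St' tt'.
    have := Sthin _ _ St St'; rewrite !tnthS; apply=> k.
    case: (unliftP ord0 k) => [k'|] -> kj; last by rewrite !tnth0.
    by rewrite !tnthS tt'//; apply: contra_neq kj => ->.
- move=> a _ na /=; rewrite (_ : xsection A a = set0) ?measure0//.
  apply/seteqP; split=> // t /xsectionP/Abox[+ _].
  by move: na; rewrite /I0/= in_itv/= -ler_distl.
Qed.

End tuple_measurability.

(** * The boundary layer *)

Lemma closed_within_preimage {X Y : topologicalType} (K : set X) (C : set Y)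
    (f : X -> Y) :
  closed K -> closed C -> {within K, continuous f} -> closed (K `&` f @^-1` C).
Proof.
move=> Kc Cc /continuous_closedP/(_ C Cc)/closed_subspaceP[V Vc VK].
by rewrite setIC -VK; exact: closedI.
Qed.

Lemma bounded_set_closure {R : realType} {V : normedModType R} (A : set V) :
  bounded_set A -> bounded_set (closure A).
Proof.
move=> [M [Mr HM]]; exists M; split => // N MN.
have AB : A `<=` closed_ball_ Num.norm 0 N.
  by move=> z /(HM _ MN) zN; rewrite /closed_ball_/= sub0r normrN.
move=> z Az; have : closed_ball_ Num.norm 0 N z.
  by apply: (@closed_closed_ball_ _ _ 0 N); exact: closureS Az.
by rewrite /closed_ball_/= sub0r normrN.
Qed.

Section domain.
Context {R : realType} {n : nat}.
Variable Omega : set 'rV[R]_n.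
Hypothesis Oo : open Omega.

Lemma boundary_open x : boundary Omega x <-> closure Omega x /\ ~ Omega x.
Proof. by rewrite /boundary /setD/= (interior_id Omega).1. Qed.

Lemma compact_closure : bounded_set Omega -> compact (closure Omega).
Proof.
move=> Ob; apply: bounded_closed_compact; last exact: closed_closure.
exact: bounded_set_closure.
Qed.

Lemma compact_boundary : bounded_set Omega -> compact (boundary Omega).
Proof.
move=> /compact_closure Oc; apply: (subclosed_compact _ Oc); last by move=> z [].
rewrite /boundary setDE; apply: closedI; first exact: closed_closure.
exact/open_closedC/open_interior.
Qed.

(** The segment from [x] to a point outside the domain is connected, so it meets
    the boundary: else its part in the domain would be open and closed in it. *)
Lemma boundary_near (r : R) x : Omega x -> ~ deep Omega r x ->
  exists2 y, boundary Omega y & `|x - y| <= r.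
Proof.
move=> Ox /existsNP[z /not_implyP[zx nOz]].
pose gam (h : R) : 'rV[R]_n := h *: (z - x) + x.
have gamc : continuous gam.
  move=> h; apply: cvgD; last exact: cvg_cst.
  by apply: cvgZr_tmp; exact: cvg_id.
have gamx h : `[0, 1]%classic h -> `|x - gam h| <= r.
  rewrite /= in_itv/= => /andP[h0 h1]; rewrite distrC addrK normrZ ger0_norm//.
  by apply: le_trans zx; rewrite ler_piMl.
apply: contrapT => nbd.
pose J := `[(0 : R), 1]%classic.
have nb h : J h -> closure Omega (gam h) -> Omega (gam h).
  move=> Ih cl; apply: contrapT => nO; apply: nbd; exists (gam h).
    exact/boundary_open.
  exact: gamx.
have /(_ (J `&` gam @^-1` Omega)) : connected J by exact: segment_connected.
move=> H; have : J `&` gam @^-1` Omega = J.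
  apply: H.
  - exists 0; split; first by rewrite /J /= in_itv/= lexx ler01.
    by rewrite /= /gam scale0r add0r.
  - exists (gam @^-1` Omega) => //.
    by move/continuousP : gamc; exact.
  - exists (gam @^-1` closure Omega).
      by move/continuous_closedP : gamc; apply; exact: closed_closure.
    apply/seteqP; split=> h [Ih Oh]; split=> //; first exact: subset_closure.
    exact: nb.
move=> /seteqP[_ /(_ 1)]; rewrite /J /= in_itv/= ler01 lexx => /(_ isT)[_].
by rewrite /gam scale1r subrK.
Qed.

Section strip.
Variables (x0 : 'rV[R]_n) (r : R) (rho : 'rV[R]_n -> R) (i : 'I_n) (eta L : R).
Hypothesis hch : boundary_chart Omega x0 r rho i eta L.

(** The points of the chart at distance at most [delta] from the boundary satisfy
    this bound on [rho], because [rho] vanishes on the boundary and is Lipschitz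
    with constant [n L]. *)
Definition chart_strip (delta : R) : set 'rV[R]_n :=
  closed_ball_ Num.norm x0 (2 * r) `&` rho @^-1` [set a | `|a| <= n%:R * L * delta].

Lemma chart_strip_closed delta : closed (chart_strip delta).
Proof.
have r0 := chart_r hch.
apply: closed_within_preimage.
- exact: closed_closed_ball_.
- apply: (preimage_closed _ (@closed_le _ _)) => a _.
  exact: norm_continuous.
- apply: continuous_in_subspaceT => z; rewrite inE /closed_ball_/= distrC => zx.
  by apply: (chart_cont hch); apply: le_trans zx _; lra.
Qed.

Lemma chart_strip_mem delta x y : delta <= r -> boundary Omega y ->
  `|y - x0| <= r -> `|x - y| <= delta -> chart_strip delta x.
Proof.
move=> dr bdy yx xy; have r0 := chart_r hch; have L0 := chart_L hch.
have xyr : `|x - y| <= r := le_trans xy dr.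
have xx0 : `|x - x0| <= 2 * r by apply: (le_dist_add xyr yx); lra.
split; first by rewrite /closed_ball_/= distrC.
have y0 : rho y = 0.
  by apply/(chart_bd hch) => //; apply: le_trans yx _; lra.
rewrite /= -[rho x]subr0 -y0 -{1}(subrK y x).
apply: le_trans (@partial_lipschitz _ _ rho y (x - y) L _ _) _.
- move=> z k zy; apply: (chart_d hch).
  by apply: (le_dist_add (le_trans zy xyr) yx); lra.
- move=> z k zy; apply: (chart_dL hch).
  by apply: (le_dist_add (le_trans zy xyr) yx); lra.
- by rewrite ler_wpM2l// mulr_ge0.
Qed.

(** In the direction [i], [rho] changes at a rate of at least [eta], while its
    values on the strip differ by at most [2 n L delta]. *)
Lemma chart_strip_thin delta x a : 0 <= delta ->
  chart_strip delta x -> chart_strip delta (a *: basis_vec i + x) ->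
  `|a| <= 2 * n%:R * L * delta / eta.
Proof.
move=> d0 [xb xs] [yb ys]; have r0 := chart_r hch; have eta0 := chart_eta hch.
have near h : 0 <= h <= 1 -> `|(h * a) *: basis_vec i + x - x0| <= 3 * r.
  move=> /andP[h0 h1].
  have -> : (h * a) *: basis_vec i + x - x0 =
      h *: (a *: basis_vec i + x - x0) + (1 - h) *: (x - x0).
    by apply/rowP => k; rewrite !mxE; ring.
  apply: le_trans (ler_normD _ _) _; rewrite !normrZ ger0_norm// ger0_norm ?subr_ge0//.
  apply: (@le_trans _ _ (h * (2 * r) + (1 - h) * (2 * r))); last lra.
  move: xb yb; rewrite /closed_ball_/= ![`|x0 - _|]distrC => xb yb.
  by apply: lerD; rewrite ler_wpM2l// subr_ge0.
have [h hI E] := mvt_line (fun h hI => chart_d hch (k:=i) (near h hI)).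
rewrite ler_pdivlMr//.
apply: (@le_trans _ _ (`|a| * `|partial i rho ((h * a) *: basis_vec i + x)|)).
  by rewrite ler_wpM2l// (chart_di hch)// near.
rewrite -normrM -E; apply: le_trans (ler_normB _ _) _.
by move: xs ys => /= xs ys; lra.
Qed.

Lemma chart_strip_measure delta : 0 <= delta ->
  (lebesgue_tuple n (@row_of_tuple R n @^-1` chart_strip delta) <=
   (4 * n%:R * L / eta * (4 * r) ^+ n.-1 * delta)%:E)%E.
Proof.
move=> d0; have r0 := chart_r hch; have eta0 := chart_eta hch; have L0 := chart_L hch.
have := @lebesgue_tuple_thin R n x0 (2 * r) (2 * n%:R * L * delta / eta) i
  (@row_of_tuple R n @^-1` chart_strip delta).
move=> /(_ _ _ (measurable_row_of_tuple_closed (@chart_strip_closed delta))).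
have -> : 4 * n%:R * L / eta * (4 * r) ^+ n.-1 * delta =
   2 * (2 * n%:R * L * delta / eta) * (2 * (2 * r)) ^+ n.-1.
  have -> : 2 * (2 * r) = 4 * r by ring.
  by ring.
apply.
- by rewrite mulr_ge0// ltW.
- by rewrite !mulr_ge0// invr_ge0 ltW.
- move=> t [+ _] k; rewrite /closed_ball_/= distrC => tb.
  by have := le_trans (rV_norm_coord _ k) tb; rewrite !mxE.
- move=> t t' St St' tt'; rewrite distrC.
  apply: (@chart_strip_thin delta (row_of_tuple t)) => //.
  rewrite (_ : _ + _ = row_of_tuple t')//.
  apply/rowP => k; rewrite !mxE eqxx/=; have [->|ki] := eqVneq k i.
    by rewrite mulr1 subrK.
  by rewrite mulr0 add0r tt'.
Qed.

End strip.

End domain.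

Section uniform.
Context {R : realType} {n : nat}.
Variable Omega : set 'rV[R]_n.
Hypothesis hO : smooth_bounded_domain Omega.

Let Oo : open Omega. Proof. by case: hO. Qed.
Let bdc : compact (boundary Omega).
Proof. by case: hO => *; exact: compact_boundary. Qed.
Let sm : smooth_boundary Omega. Proof. by case: hO. Qed.

Lemma uniform_interior_ball : exists2 s0 : R, 0 < s0 & forall x nu s,
  boundary Omega x -> outward_unit_normal Omega x nu -> 0 < s <= s0 ->
  interior_ball Omega x nu s.
Proof.
have := @compact_local_ind _ _ (boundary Omega) (fun A => exists2 s0 : R, 0 < s0 &
  forall x nu s, A x -> boundary Omega x -> outward_unit_normal Omega x nu ->
  0 < s <= s0 -> interior_ball Omega x nu s) bdc.
case.
- by exists 1.
- move=> A B [s1 s10 H1] [s2 s20 H2]; exists (Num.min s1 s2).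
    by rewrite lt_min s10.
  move=> x nu s AB bx hnu /andP[s0]; rewrite le_min => /andP[ss1 ss2].
  by case: AB => [Ax|Bx]; [apply: H1|apply: H2] => //; rewrite s0.
- move=> A B AB [s1 s10 H1]; exists s1 => // x nu s /AB; exact: H1.
- move=> x0 bx0; have [r [rho [i [eta [L hch]]]]] := exists_chart sm bx0.
  exists r; first exact: chart_r hch.
  exists (@chart_radius R n r eta L); first exact: chart_radius_gt0 hch.
  by move=> x nu s /ltW xr bx hnu sI; exact: (chart_interior_ball hch).
- by move=> s0 s00 H; exists s0 => // x nu s bx; exact: H.
Qed.

(** Points that are not deep are close to the boundary ([boundary_near]), so they
    lie in one of finitely many chart strips. *)
Lemma boundary_layer_measure : exists (C d0 : R), [/\ 0 <= C, 0 < d0 &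
  forall d, 0 < d <= d0 -> exists S : set 'rV[R]_n,
    [/\ measurable (@row_of_tuple R n @^-1` S),
       (lebesgue_tuple n (@row_of_tuple R n @^-1` S) <= (C * d)%:E)%E &
       forall x, Omega x -> ~ deep Omega d x -> S x] ].
Proof.
have := @compact_local_ind _ _ (boundary Omega) (fun A => exists (C d0 : R),
  [/\ 0 <= C, 0 < d0 & forall d, 0 < d <= d0 -> exists S : set 'rV[R]_n,
    [/\ measurable (@row_of_tuple R n @^-1` S),
       (lebesgue_tuple n (@row_of_tuple R n @^-1` S) <= (C * d)%:E)%E &
       forall x y, boundary Omega y -> A y -> `|x - y| <= d -> S x] ]) bdc.
case.
- exists 0, 1; split => // d dI; exists set0; rewrite preimage_set0; split => //.
  by rewrite measure0 mul0r.
- move=> A B [C1 [d1 [C10 d10 H1]]] [C2 [d2 [C20 d20 H2]]].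
  exists (C1 + C2), (Num.min d1 d2); split; [exact: addr_ge0|by rewrite lt_min d10|].
  move=> d /andP[d0]; rewrite le_min => /andP[dd1 dd2].
  have [|S1 [mS1 muS1 S1P]] := H1 d; first by rewrite d0.
  have [|S2 [mS2 muS2 S2P]] := H2 d; first by rewrite d0.
  exists (S1 `|` S2); rewrite preimage_setU; split; first exact: measurableU.
    rewrite mulrDl EFinD; apply: le_trans (leeD muS1 muS2).
    exact: measureU2.
  move=> x y bdy [Ay|By] xy; [left; exact: S1P xy|right; exact: S2P xy].
- move=> A B AB [C [d0 [C0 d00 H]]]; exists C, d0; split => // d dI.
  have [S [mS muS SP]] := H d dI; exists S; split => // x y bdy /AB; exact: SP.
- move=> x0 bx0; have [r [rho [i [eta [L hch]]]]] := exists_chart sm bx0.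
  have r0 := chart_r hch; have eta0 := chart_eta hch; have L0 := chart_L hch.
  exists r => //.
  exists (4 * n%:R * L / eta * (4 * r) ^+ n.-1), r; split => //.
    by rewrite !mulr_ge0 ?invr_ge0 ?exprn_ge0// ?mulr_ge0// ltW.
  move=> d /andP[d0 dr]; exists (chart_strip x0 r rho L d); split.
  + by apply: measurable_row_of_tuple_closed; exact: chart_strip_closed hch d.
  + by apply: chart_strip_measure hch _ _; exact: ltW.
  + by move=> x y bdy /ltW yr xy; exact: (chart_strip_mem hch dr bdy yr).
- move=> C [d0 [C0 d00 H]]; exists C, d0; split => // d dI.
  have [S [mS muS SP]] := H d dI; exists S.
  split => // x Ox /(boundary_near Oo Ox)[y bdy xy].
  exact: SP xy.
Qed.

End uniform.

(** * Solutions, first times and fluxes *)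

Section space_time.
Context {R : realType} {n : nat}.
Variables (Omega : set 'rV[R]_n) (T : R).
Hypotheses (Oo : open Omega) (T0 : 0 < T).

Lemma parabolic_domainE :
  parabolic_Q Omega T `|` parabolic_Gamma Omega T =
  closure Omega `*` `[0, T[%classic.
Proof.
apply/seteqP; split=> -[x t]; rewrite /parabolic_Gamma /parabolic_S /parabolic_Q /=.
- rewrite /boundary; case=> [[Ox]|[[[Ox _]]|[Ox ->]]]; rewrite !in_itv/=.
  + by move=> /andP[t0 ->]; split; [exact: subset_closure|rewrite ltW].
  + by move=> /andP[t0 ->]; split=> //; rewrite ltW.
  + by rewrite lexx T0.
- rewrite !in_itv/= => -[Ox /andP[t0 tT]].
  have [->|tn0] := eqVneq t 0; first by right; right.
  have tp : 0 < t by rewrite lt_neqAle eq_sym tn0.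
  have [Oin|nO] := pselect (Omega x); first by left; rewrite tp.
  by right; left; split; [exact/(boundary_open Oo)|rewrite tp].
Qed.

End space_time.

Section first_time.
Context {R : realType} {V : normedModType R}.

(** The set where [u >= M] is compact and nonempty up to time [t1]; [t0] is the
    smallest time in it.  It is positive because [u] vanishes initially, and by
    continuity [u] does not exceed [M] at time [t0]. *)
Lemma first_time (K : set V) (T M : R) (u : V -> R -> R) x1 t1 :
  compact K ->
  {within K `*` `[0, T[%classic, continuous (fun z : V * R => u z.1 z.2)} ->
  (forall x, K x -> u x 0 = 0) -> 0 < M ->
  K x1 -> 0 <= t1 < T -> M <= u x1 t1 ->
  exists x0 t0, [/\ K x0, 0 < t0 < T, u x0 t0 = M &
    forall x t, K x -> 0 <= t <= t0 -> u x t <= M].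
Proof.
move=> Kc uc ui M0 Kx1 /andP[t10 t1T] Mu.
pose C := K `*` `[0, t1]%classic.
have Cc : compact C by apply: compact_setX => //; exact: segment_compact.
have Ccl : closed C by apply: compact_closed Cc; exact: norm_hausdorff.
have CT : C `<=` K `*` `[0, T[%classic.
  move=> [x t] [/= Kx]; rewrite in_itv/= => /andP[t0 tt1]; split=> //=.
  by rewrite in_itv/= t0 (le_lt_trans tt1).
pose F := C `&` (fun z : V * R => u z.1 z.2) @^-1` [set a | M <= a].
have Fc : compact F.
  apply: (subclosed_compact _ Cc); last by move=> z [].
  by apply: closed_within_preimage => //; exact: continuous_subspaceW uc.
have F0 : F !=set0 by exists (x1, t1); do 2!split=> //=; rewrite in_itv/= t10 lexx.
have sc : {within F, continuous (snd : V * R -> R)}.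
  by apply: continuous_subspaceT => z; exact: cvg_snd.
have [[x0 t0]] := compact_EVT_min F0 Fc sc.
rewrite inE => -[[/= Kx0]]; rewrite in_itv/= => /andP[t00 t0t1] Mu0 tmin.
have t0T : t0 < T by exact: le_lt_trans t1T.
have t0p : 0 < t0.
  rewrite lt_neqAle t00 andbT; apply/eqP => t0E.
  by move: Mu0; rewrite -t0E ui// leNgt M0.
have before x t : K x -> 0 <= t < t0 -> u x t < M.
  move=> Kx /andP[tp tt0]; rewrite ltNge; apply/negP => Mut.
  have /mem_set/tmin : F (x, t).
    by do 2!split=> //=; rewrite in_itv/= tp (le_trans (ltW tt0)).
  by rewrite /= leNgt tt0.
have at0 x : K x -> u x t0 <= M.
  move=> Kx; rewrite leNgt; apply/negP => Mut.
  have Kxt : (K `*` `[0, T[%classic) (x, t0) by split=> //=; rewrite in_itv/= t00.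
  have e0 : 0 < u x t0 - M by rewrite subr_gt0.
  have [d d0 Hd] := within_continuous_eps uc Kxt e0.
  pose t := t0 - Num.min d t0 / 2.
  have m0 : 0 < Num.min d t0 by rewrite lt_min d0.
  have md : Num.min d t0 <= d by rewrite ge_min lexx.
  have mt : Num.min d t0 <= t0 by rewrite ge_min lexx orbT.
  have tt0 : t < t0 by rewrite /t; lra.
  have tp : 0 <= t by rewrite /t; lra.
  have := Hd (x, t); rewrite /= => /(_ _ _).
  have h1 : (K `*` `[0, T[%classic) (x, t).
    by split=> //=; rewrite in_itv/= tp (lt_trans tt0).
  have h2 : `|(x, t) - (x, t0)| < d.
    rewrite prod_normE/= subrr normr0 gt_max d0/=.
    by rewrite distrC gtr0_norm /t; lra.
  move=> /(_ h1 h2); rewrite ltr_norml => /andP[+ _].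
  have := before x t Kx; rewrite tp tt0 => /(_ isT); lra.
exists x0, t0; split => //.
- by rewrite t0p.
- by apply/eqP; rewrite eq_le Mu0 at0.
- move=> x t Kx /andP[tp]; rewrite le_eqVlt => /predU1P[->|tt0]; first exact: at0.
  by apply: ltW; apply: before => //; rewrite tp.
Qed.

End first_time.

Section solutions.
Context {R : realType} {n : nat}.
Variables (Omega : set 'rV[R]_n) (T : R).
Variables (nu : 'rV[R]_n -> 'rV[R]_n) (p l : R).
Variables (c : 'rV[R]_n -> R -> R) (k : 'rV[R]_n -> 'rV[R]_n -> R -> R).
Hypotheses (Oo : open Omega) (T0 : 0 < T) (p0 : 0 < p) (l0 : 0 < l).

Lemma zero_is_solution : is_solution Omega T nu p l c k (fun=> 0) (fun _ _ => 0).
Proof.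
have part0 i : partial i (fun _ : 'rV[R]_n => 0 : R) = fun=> 0.
  by apply/funext => x; exact: derive_cst.
split => //.
- split.
  + move=> z _; split => [|i|i j]; rewrite ?part0; exact: derivable_cst.
  + by move=> z; exact: cst_continuous.
  + rewrite (_ : (fun z => _) = fun=> 0); first by move=> z; exact: cst_continuous.
    by apply/funext => z; exact: derive1_cst.
  + move=> i; rewrite (_ : (fun z => _) = fun=> 0).
      by move=> z; exact: cst_continuous.
    by apply/funext => z; rewrite part0.
  + move=> i j; rewrite (_ : (fun z => _) = fun=> 0).
      by move=> z; exact: cst_continuous.
    by apply/funext => z; rewrite !part0.
- move=> x t _; rewrite derive1_cst powR0 ?gt_eqF// mulr0 subr0 /laplacian.
  by rewrite big1// => i _; rewrite !part0.
- exists (fun _ _ => 0).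
    split; [by move=> z; exact: cst_continuous..|].
    move=> x t _ _; split=> [i|]; first exact: derivable_cst.
    by apply/rowP => i; rewrite !mxE part0.
  move=> x t _ _; rewrite /dot big1; last by move=> i _; rewrite mxE mul0r.
  rewrite /integral_rV integral0_eq// => y _.
  by rewrite powR0 ?gt_eqF// mulr0.
Qed.

(** The initial condition is given on the open set only; continuity up to the
    closure extends it. *)
Lemma solution_subsolution c1 u : 0 < c1 -> p < 1 ->
  (forall x t, closure Omega x -> 0 <= t <= T -> c1 <= c x t) ->
  is_solution Omega T nu p l c k (fun=> 0) u ->
  absorption_subsolution Omega T p c1 u.
Proof.
move=> c10 p1 hc1 [ge0 [uD _ _ _ _] pde [g [uc _ _] _] init].
have inQ x t : Omega x -> 0 < t < T -> parabolic_Q Omega T (x, t).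
  by move=> Ox tI; split=> //=; rewrite in_itv.
rewrite parabolic_domainE// in uc.
split => //.
- by rewrite p0.
- move=> x Ox; apply/eqP/negPn/negP => ux.
  have Dx : (closure Omega `*` `[0, T[%classic) (x, 0).
    by split=> //=; rewrite in_itv/= lexx.
  have ux0 : 0 < `|u x 0| by rewrite normr_gt0.
  have [d d0 Hd] := within_continuous_eps uc Dx ux0.
  have [z [Oz]] := Ox _ (nbhsx_ballx x d d0).
  rewrite -ball_normE/= distrC => zx.
  have Dz : (closure Omega `*` `[0, T[%classic) (z, 0).
    by split=> /=; [exact: subset_closure|rewrite in_itv/= lexx].
  have := Hd _ Dz; rewrite prod_normE/= subrr normr0 gt_max zx d0 => /(_ isT).
  by rewrite /= (init z Oz) sub0r normrN ltxx.
- by move=> x t Ox tI; have [] := uD _ (inQ _ _ Ox tI).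
- by move=> x t i Ox tI; have [_ + _] := uD _ (inQ _ _ Ox tI); exact.
- by move=> x t i Ox tI; have [_ _] := uD _ (inQ _ _ Ox tI); exact.
- move=> x t Ox tI; rewrite -derive1E pde; last exact: inQ.
  rewrite lerD2l lerN2 ler_wpM2r ?powR_ge0//; apply: hc1; first exact: subset_closure.
  by case/andP: tI => *; rewrite !ltW.
Qed.

Lemma flux_le (S : set 'rV[R]_n) (K M B : R) (kx ut : 'rV[R]_n -> R) :
  0 <= K -> 0 <= M ->
  (forall y, Omega y -> 0 <= kx y <= K) ->
  (forall y, Omega y -> 0 <= ut y <= M) ->
  (forall y, Omega y -> ~ S y -> ut y = 0) ->
  measurable (@row_of_tuple R n @^-1` S) ->
  (lebesgue_tuple n (@row_of_tuple R n @^-1` S) <= B%:E)%E ->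
  (integral_rV Omega (fun y => (kx y * ut y `^ l)%:E) <= (K * M `^ l * B)%:E)%E.
Proof.
move=> K0 M0 kK uM uS mS SB.
apply: (@le_trans _ _ ((K * M `^ l)%:E * lebesgue_tuple n (@row_of_tuple R n @^-1` S))%E).
  apply: integral_le_indic => //.
  - by rewrite mulr_ge0// powR_ge0.
  - move=> t Ot; have /andP[k0 _] := kK _ Ot.
    by rewrite lee_fin mulr_ge0// powR_ge0.
  - move=> t Ot _; have /andP[k0 kK'] := kK _ Ot; have /andP[u0 uM'] := uM _ Ot.
    rewrite lee_fin ler_pM ?powR_ge0// ge0_ler_powR// ?nnegrE//; exact: ltW.
  - by move=> t Ot nS; rewrite uS// powR0 ?gt_eqF// mulr0.
rewrite (EFinM (K * M `^ l)); apply: lee_wpmul2l => //.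
by rewrite lee_fin mulr_ge0// powR_ge0.
Qed.

End solutions.

Lemma expr_eventually_lt {R : realType} (z e : R) : 0 <= z < 1 -> 0 < e ->
  \forall k \near \oo, z ^+ k < e.
Proof.
move=> /andP[z0 z1] e0.
have : z ^+ k @[k --> \oo] --> 0 by apply: cvg_expr; rewrite ger0_norm.
move=> /cvgrPdist_lt/(_ _ e0); apply: filterS => k.
by rewrite sub0r normrN ger0_norm// exprn_ge0.
Qed.

(** * Uniqueness *)

Section small_maximum.
Context {R : realType} {n : nat}.
Variables (Omega : set 'rV[R]_n) (T : R).
Variables (nu : 'rV[R]_n -> 'rV[R]_n) (p l : R).
Variables (c : 'rV[R]_n -> R -> R) (k : 'rV[R]_n -> 'rV[R]_n -> R -> R).
Variable u : 'rV[R]_n -> R -> R.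
Variables (c1 K : R).
Hypotheses (hn : (0 < n)%N) (hO : smooth_bounded_domain Omega).
Hypothesis hnu : forall x, boundary Omega x -> outward_unit_normal Omega x (nu x).
Hypotheses (T0 : 0 < T) (p0 : 0 < p) (pl : p < l) (l1 : l < 1).
Hypotheses (c10 : 0 < c1)
  (hc1 : forall x t, closure Omega x -> 0 <= t <= T -> c1 <= c x t).
Hypothesis K0 : 0 <= K.
Hypothesis hK : forall x y t, boundary Omega x -> closure Omega y ->
  0 <= t <= T -> 0 <= k x y t <= K.
Hypothesis hu : is_solution Omega T nu p l c k (fun=> 0) u.

Local Notation s := (core_width n p c1).
Local Notation q := (curvature n p c1).
Local Notation depth := (@core_depth R n p c1).

Let Oo : open Omega. Proof. by case: hO. Qed.

(** The normal derivative at the maximum point is bounded below by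
    [boundary_slope] and above by the flux, which sees only the layer outside the
    dead core.  The maximum point is on the boundary, since at an interior one
    [absorption_le_at_max] with the flat barrier [q = 0] would give
    [c1 M^p <= 0]. *)
Lemma max_flux_balance (s0 C d0 M : R) x0 t0 :
  (forall x nu s, boundary Omega x -> outward_unit_normal Omega x nu ->
    0 < s <= s0 -> interior_ball Omega x nu s) ->
  0 <= C ->
  (forall d, 0 < d <= d0 -> exists S : set 'rV[R]_n,
    [/\ measurable (@row_of_tuple R n @^-1` S),
       (lebesgue_tuple n (@row_of_tuple R n @^-1` S) <= (C * d)%:E)%E &
       forall x, Omega x -> ~ deep Omega d x -> S x]) ->
  0 < M -> s M <= s0 -> depth M <= d0 ->
  closure Omega x0 -> 0 < t0 < T -> u x0 t0 = M ->
  (forall x t, closure Omega x -> 0 <= t <= t0 -> u x t <= M) ->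
  2 * q M * s M <= K * M `^ l * (C * depth M).
Proof.
move=> ball C0 layer M0 sM dM x0O t0I ux0 uM.
have /andP[t00 t0T] := t0I.
have p1 : p < 1 := lt_trans pl l1.
have sub := solution_subsolution Oo T0 p0 c10 p1 hc1 hu.
have OC := @subset_closure _ Omega.
have [ge0 _ _ [g [uc gc ggrad] gflux] _] := hu.
rewrite parabolic_domainE// in ge0 gc ggrad.
have dom x t : closure Omega x -> 0 <= t < T ->
    (closure Omega `*` `[0, T[%classic) (x, t).
  by move=> Ox tI; split=> //=; rewrite in_itv.
have t0I' : 0 <= t0 < T by rewrite ltW.
have bx0 : boundary Omega x0.
  apply/(boundary_open Oo); split => // Ox0.
  have /nbhs_ballP[e /= e0 He] := open_nbhs_nbhs (conj Oo Ox0).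
  have m0 : 0 < Num.min e t0 by rewrite lt_min e0.
  have := @absorption_le_at_max _ _ _ _ _ _ _ sub x0 t0 0 0 (Num.min e t0) Ox0 t0I m0.
  rewrite mulr0 ux0 leNgt mulr_gt0// ?powR_gt0//=.
  move=> H; suff : false by []; apply: H.
  - move=> z; rewrite lt_min !mul0r !subr0 => /andP[ze _].
    apply: uM; last by rewrite lexx ltW.
    by apply: OC; apply: He; rewrite -ball_normE/= distrC.
  - move=> t; have : Num.min e t0 <= t0 by rewrite ge_min lexx orbT.
    move=> mt td tt0; apply: uM => //; rewrite tt0 andbT; lra.
have nu1 := unit_normal_dot (hnu bx0).
have sM0 : 0 < s M by exact: core_width_gt0.
have ballM : interior_ball Omega x0 (nu x0) (s M).
  by apply: ball; [exact: bx0|exact: hnu|rewrite sM0].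
have gct : {within closure Omega, continuous (g^~ t0)}.
  have := fun h1 h2 => @within_continuous_precomp _ _ _ _ (closure Omega) _
    (fun z : 'rV[R]_n => (z, t0)) h1 h2 gc.
  apply; first exact: continuous_pairr.
  by move=> z Oz; exact: dom.
have gE x : Omega x -> gradient (u^~ t0) x = g x t0.
  by move=> Ox; have [] := ggrad x t0 Ox (dom _ _ (OC _ Ox) t0I').
have slope := boundary_slope hn sub nu1 x0O ballM M0 t0I uM ux0 gct gE.
have dpos : 0 < depth M.
  by rewrite divr_gt0// subr_gt0 core_ratio_lt1// p0.
have [|S [mS muS SP]] := layer (depth M); first by rewrite dpos.
apply: le_trans slope _; rewrite -lee_fin gflux//.
apply: (flux_le (lt_trans p0 pl) (S := S)) => //.
- exact: ltW.
- by move=> y Oy; apply: hK => //; [exact: OC|rewrite !ltW].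
- move=> y Oy; apply/andP; split; first by apply: ge0; apply: dom => //; exact: OC.
  by apply: uM; [exact: OC|rewrite lexx ltW].
- move=> y Oy nSy; apply/eqP; rewrite eq_le; apply/andP; split; last first.
    by apply: ge0; apply: dom => //; exact: OC.
  apply: (dead_core hn sub t0T M0) => //.
  + by move=> x t Ox tI; apply: uM => //; exact: OC.
  + by apply: contrapT => nd; apply: nSy; exact: SP.
  + by rewrite lexx ltW.
Qed.

End small_maximum.

Unset Implicit Arguments.

Theorem theorem3p8 (R : realType) (n : nat) (hn : (0 < n)%N)
    (Omega : set 'rV[R]_n) (hOmega : smooth_bounded_domain Omega)
    (nu : 'rV[R]_n -> 'rV[R]_n)
    (hnu : forall x, boundary Omega x -> outward_unit_normal Omega x (nu x))
    (p l : R) (hp : 0 < p) (hl : 0 < l)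
    (alpha : R) (halpha : 0 < alpha < 1)
    (c : 'rV[R]_n -> R -> R)
    (hc : locally_hoelder alpha
      (closure Omega `*` [set t : R | 0 <= t]) (fun z => c z.1 z.2))
    (hc_ge0 : forall x t, closure Omega x -> 0 <= t -> 0 <= c x t)
    (k : 'rV[R]_n -> 'rV[R]_n -> R -> R)
    (hk : {within boundary Omega `*` closure Omega `*` [set t : R | 0 <= t],
      continuous (fun z : 'rV[R]_n * 'rV[R]_n * R => k z.1.1 z.1.2 z.2)})
    (hk_ge0 : forall x y t, boundary Omega x -> closure Omega y -> 0 <= t ->
      0 <= k x y t)
    (T : R) (hT : 0 < T) (hpl : p < l) (hl1 : l < 1)
    (hc1 : exists c1 : R, 0 < c1 /\
      forall x t, closure Omega x -> 0 <= t <= T -> c1 <= c x t) :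
  is_solution Omega T nu p l c k (fun=> 0) (fun _ _ => 0) /\
  forall u, is_solution Omega T nu p l c k (fun=> 0) u ->
    forall x t, (parabolic_Q Omega T `|` parabolic_Gamma Omega T) (x, t) ->
      u x t = 0.
Proof.
split; first exact: zero_is_solution.
move=> u hu x1 t1 Qxt; have [_ Oo _ Ob _] := hOmega.
have [ge0 _ _ _ _] := hu.
apply/eqP; rewrite eq_le ge0// andbT leNgt; apply/negP => u1.
rewrite (parabolic_domainE Oo hT) in Qxt.
case: Qxt => /= Ox1; rewrite in_itv/= => t1I.
have [c1 [c10 c1P]] := hc1.
have p1 : p < 1 := lt_trans hpl hl1.
have hp01 : 0 < p < 1 by rewrite hp.
have sub := solution_subsolution Oo hT hp c10 p1 c1P hu.
have [s0 s00 ball] := uniform_interior_ball hOmega.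
have [C [d0 [C0 d00 layer]]] := boundary_layer_measure hOmega.
have [K [K0 KP]] : exists K : R, 0 <= K /\ forall x y t, boundary Omega x ->
    closure Omega y -> 0 <= t <= T -> 0 <= k x y t <= K.
  pose A := boundary Omega `*` closure Omega `*` `[0, T]%classic.
  have Ac : compact A.
    apply: compact_setX; last exact: segment_compact.
    by apply: compact_setX; [exact: compact_boundary|exact: compact_closure].
  have : bounded_set ((fun z : 'rV[R]_n * 'rV[R]_n * R => k z.1.1 z.1.2 z.2) @` A).
    apply/compact_bounded/continuous_compact => //.
    apply: continuous_subspaceW hk => -[[x y] t] [/= xy].
    by rewrite in_itv/= => /andP[t0 _]; split.
  move=> [M [_ HM]]; exists (`|M| + 1); split; first by rewrite addr_ge0.
  move=> x y t bx cy tI; have /andP[t0 _] := tI; rewrite hk_ge0//=.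
  apply: le_trans (ler_norm _) _; apply: HM.
    by rewrite (le_lt_trans (ler_norm M))// ltrDl.
  by exists (x, y, t); rewrite //=; do 2!split => //=; rewrite in_itv.
pose th := core_ratio p; pose h := 2^-1 `^ p : R.
have th0 : 0 <= th by exact: core_ratio_ge0.
have th1 : th < 1 by exact: core_ratio_lt1.
have h0 : 0 < h by rewrite powR_gt0// invr_gt0.
have s10 : 0 < core_width n p c1 1 by exact: core_width_gt0.
have n0 : 0 < n%:R :> R by rewrite ltr0n.
(* the final balance fails once [M `^ (l - p) < e] *)
pose e := c1 * h * (1 - th) / (n%:R * (K * C + 1)).
have KC : 0 <= K * C by rewrite mulr_ge0.
have e0 : 0 < e.
  by rewrite divr_gt0 ?mulr_gt0 ?subr_gt0// ltr_wpDl.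
(* heights are taken of the form [2^-m], for which all lengths are geometric *)
have half01 : (0 : R) <= (2^-1 : R) < 1 by apply/andP; split; lra.
have th01 : 0 <= th < 1 by rewrite th0.
have z01 : (0 : R) <= 2^-1 `^ (l - p) < 1.
  rewrite powR_ge0/= -[ltRHS](_ : 1 `^ (l - p) = 1); last by rewrite powR1.
  case/andP: half01 => ? ?.
  by rewrite gt0_ltr_powR ?subr_gt0 ?nnegrE.
have e1 : 0 < s0 / core_width n p c1 1 by rewrite divr_gt0.
have e2 : 0 < d0 * (1 - th) / core_width n p c1 1.
  by rewrite divr_gt0// mulr_gt0// subr_gt0.
have [m [[m1 m2] [m3 m4]]] : exists m, (2^-1 ^+ m < u x1 t1 /\
    (2^-1 `^ (l - p)) ^+ m < e) /\
    (th ^+ m < s0 / core_width n p c1 1 /\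
     th ^+ m < d0 * (1 - th) / core_width n p c1 1).
  have := filterI (filterI (expr_eventually_lt half01 u1) (expr_eventually_lt z01 e0))
    (filterI (expr_eventually_lt th01 e1) (expr_eventually_lt th01 e2)).
  by move=> [N _ HN]; exists N; have := HN N (leqnn N).
pose M : R := 1 / 2 ^+ m.
have M0 : 0 < M by rewrite divr_gt0// exprn_gt0.
have ME : M = 2^-1 ^+ m by rewrite /M div1r exprVn.
have sME : core_width n p c1 M = core_width n p c1 1 * th ^+ m.
  exact: core_width_exp.
have sM : core_width n p c1 M <= s0.
  by rewrite sME mulrC -ler_pdivlMr// ltW.
have dM : @core_depth R n p c1 M <= d0.
  rewrite /core_depth ler_pdivrMr ?subr_gt0// sME mulrC -ler_pdivlMr// ltW//.
have uM1 : M <= u x1 t1 by rewrite ME ltW.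
have [x0 [t0 [Ox0 t0I ux0 uM]]] :=
  first_time (compact_closure Ob) (sub_cont sub) (sub_init sub) M0 Ox1 t1I uM1.
have := max_flux_balance hn hOmega hnu hT hp hpl hl1 c10 c1P K0 KP hu ball C0 layer
  M0 sM dM Ox0 t0I ux0 uM.
rewrite leNgt => /negP; apply.
have sM0 : 0 < core_width n p c1 M by exact: core_width_gt0.
have -> : K * M `^ l * (C * @core_depth R n p c1 M) =
   (K * C * M `^ l / (1 - th)) * core_width n p c1 M.
  by rewrite /core_depth -/th; ring.
rewrite ltr_pM2r// ltr_pdivrMr ?subr_gt0//.
have Ml : M `^ l = M `^ p * (2^-1 `^ (l - p)) ^+ m.
  have -> : (2^-1 `^ (l - p)) ^+ m = M `^ (l - p).
    rewrite -powR_mulrn ?powR_ge0// powRAC powR_mulrn ?ME//.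
  rewrite -powRD; last by rewrite (gt_eqF M0) implybT.
  by rewrite addrC subrK.
have qM : 2 * curvature n p c1 M = c1 * h * M `^ p / n%:R.
  rewrite /curvature powRM ?invr_ge0// ?ltW// -/h.
  by field; rewrite gt_eqF.
rewrite qM Ml.
have Mp : 0 < M `^ p by rewrite powR_gt0.
set zm := (2^-1 `^ (l - p)) ^+ m in m2 *.
have zm0 : 0 <= zm by rewrite exprn_ge0// powR_ge0.
move: m2; rewrite /e ltr_pdivlMr; last by rewrite mulr_gt0// ltr_wpDl.
move=> m2.
have -> : K * C * (M `^ p * zm) = n%:R * (K * C) * zm * (M `^ p / n%:R).
  by field; rewrite gt_eqF.
have -> : c1 * h * M `^ p / n%:R * (1 - th) = c1 * h * (1 - th) * (M `^ p / n%:R).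
  by ring.
rewrite ltr_pM2r ?divr_gt0//; apply: le_lt_trans m2.
by rewrite [leRHS]mulrC ler_wpM2r// ler_wpM2l// ?ltW// ltrDl.
Qed.
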